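(* For all $c\ge 0$, $$\lim_{n\to\infty}\frac1{n^{1/2}}\log P\big(L_{\max}(n)\ge(2+c)\sqrt n\big)=-U_0(c),$$ where $U_0:[0,\infty)\to[0,\infty)$ is a continuous, strictly increasing, convex function with $U_0(c)=0$ if and only if $c=0$, and, for all $c\ge 0$, $$U_0(c)=2(2+c)\cosh^{-1}\Big(\frac c2+1\Big)-2\sqrt{c^2+4c}.$$
   Context: $L_{\max}(n)$ denotes the length of the longest increasing subsequence of a uniformly random permutation of $\{1,\dots,n\}$. (Equivalently in law: for $n$ i.i.d. points $(X_i,Y_i)$ uniformly distributed on $[0,1]^2$, it is the maximal $\ell$ for which there are indices $i_1,\dots,i_\ell$, not required to be increasing, with $X_{i_j}<X_{i_{j+1}}$ and $Y_{i_j}<Y_{i_{j+1}}$ for $j=1,\dots,\ell-1$.) Here $\cosh^{-1}:[1,\infty)\to[0,\infty)$ is the inverse hyperbolic cosine. *)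

(* Defs.v *)
From mathcomp Require Import all_boot all_order all_algebra all_fingroup.
From mathcomp Require Import all_classical all_reals all_analysis.
From mathcomp Require Import ring lra.

Set Implicit Arguments.
Unset Strict Implicit.
Unset Printing Implicit Defensive.

Import Order.TTheory GRing.Theory Num.Theory.
Import numFieldNormedType.Exports.

Local Open Scope classical_set_scope.
Local Open Scope ring_scope.

(* A subsequence of (s 0, ..., s (n - 1)) is given by its set of positions. *)
Definition increasing_on n (s : 'S_n) (A : {set 'I_n}) : bool :=
  [forall i in A, forall j in A, (i < j)%N ==> (s i < s j)%N].

Definition Lmax n (s : 'S_n) : nat :=
  (\max_(A : {set 'I_n} | increasing_on s A) #|A|)%N.

Definition uniform_perm_prob (R : realType) n (E : pred 'S_n) : R :=
  #|E|%:R / #|{: 'S_n}|%:R.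

Definition cosh (R : realType) (x : R) : R := (expR x + expR (- x)) / 2.

(* The inverse of [cosh] restricted to [0, +oo[; its value is meaningful on
   [1, +oo[ only, see [acoshP] and [coshK]. *)
Definition acosh (R : realType) (y : R) : R :=
  [get x : R | 0 <= x /\ cosh x = y].

Definition U0 (R : realType) (c : R) : R :=
  2 * (2 + c) * acosh (c / 2 + 1) - 2 * Num.sqrt (c ^+ 2 + 4 * c).

Lemma cosh_inj (R : realType) (x y : R) :
  0 <= x -> 0 <= y -> cosh x = cosh y -> x = y.
Proof.
rewrite /cosh !expRN => x0 y0 e; apply: expR_inj.
have a1 : 1 <= expR x by rewrite -(expR0 R) ler_expR.
have b1 : 1 <= expR y by rewrite -(expR0 R) ler_expR.
move: (expR x) (expR y) a1 b1 e => a b a1 b1 e.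
have an0 : a != 0 by rewrite gt_eqF// (lt_le_trans _ a1).
have bn0 : b != 0 by rewrite gt_eqF// (lt_le_trans _ b1).
have : (a - b) * (a * b - 1) = 0.
  have -> : (a - b) * (a * b - 1) = a * b * ((a + a^-1) - (b + b^-1)).
    by field; rewrite an0 bn0.
  by rewrite (mulIf _ e) ?pnatr_eq0 ?invr_eq0 ?pnatr_eq0// subrr mulr0.
move/eqP; rewrite mulf_eq0 !subr_eq0 => /orP[/eqP//|/eqP ab].
by nra.
Qed.

Lemma acoshP (R : realType) (y : R) :
  1 <= y -> 0 <= acosh y /\ cosh (acosh y) = y.
Proof.
move=> y1; rewrite /acosh.
case: xgetP => [x _ //|/(_ (ln (y + Num.sqrt (y ^+ 2 - 1))))[]].
set r := Num.sqrt _.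
have r0 : 0 <= r by exact: sqrtr_ge0.
have r2 : r ^+ 2 = y ^+ 2 - 1 by rewrite sqr_sqrtr// subr_ge0 exprn_ege1.
split; first by rewrite ln_ge0//; lra.
have p0 : 0 < y + r by lra.
rewrite /cosh expRN lnK ?posrE//.
have -> : (y + r)^-1 = y - r.
  by apply: (mulfI (lt0r_neq0 p0)); rewrite divff ?gt_eqF// mulrC -subr_sqr r2; ring.
by field.
Qed.

Lemma coshK (R : realType) (x : R) : 0 <= x -> acosh (cosh x) = x.
Proof.
move=> x0; rewrite /acosh; case: xgetP => [z _ /= [z0 e]|/(_ x) []//].
exact: cosh_inj.
Qed.

(* Main.v *)
Require Import Defs.
From mathcomp Require Import all_boot all_order all_algebra all_fingroup.
From mathcomp Require Import all_classical all_reals all_analysis.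
From mathcomp Require Import ring lra zify.
(* Last, so that the finite-set lemmas take precedence over their homonyms. *)
From mathcomp Require Import fintype finset.

(** Write E_n(r) for the average of r ^ Lmax over the permutations of n
    letters. The two sides of the rate come from
      E_n(e^(2u)) = exp(4 sinh u * sqrt n * (1 + o(1))),    u > 0,
    because U0 is its Legendre transform: with x = 2 + c,
      U0(c) = max over u >= 0 of (2 u x - 4 sinh u),   attained at cosh u = x/2.
    The upper bound is then the Chernoff inequality. For the lower bound, tilt
    the uniform law by e^(2uL) with u slightly above the maximizer: strict
    convexity of sinh makes the values of L below x sqrt n, and those far above,
    exponentially negligible, and the weight left is at most a known exponential
    times the tail probability.

    The moments are computed through a model with an exact invariance. Take a
    permutation s of N letters and a set K of columns whose points are erased.
    Put a source at the bottom of every erased column and on the left of every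
    row without a point. Sources on the left emit horizontal lines, sources at
    the bottom vertical ones, a point emits one line to the right and one
    upward, and lines that meet stop each other (Hammersley's process). Two facts
    hold.

    - Counting lines measures chains: the number of bottom sources plus the
      number of horizontal lines that leave on the right is the length of a
      longest increasing chain which may begin with bottom sources, or with left
      sources, before it continues through points (increasing_le_line_count,
      line_count_exit).

    - Burke property: when (s, K) has weight 1/|K|!, the number of lines that
      leave on the right is distributed as the number of those that enter on the
      left, that is |K| (burke_alive). The reason is that a column can be read
      backwards (burke_column).

    Let Phi_N(r) be the sum over K of r^|K| / |K|!, which grows like
    exp(2 sqrt(r N)). The Burke property says that Phi_N(r) is the weighted
    average of r^(chain - |K|), chain being the length of the chains above.

    Upper bound for E_n (lis_mgf_le): the chain is at least the longest
    increasing subsequence of the points, an average permutation of N - |K|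
    letters. So, for N = n + k, the sets K of size k alone give
    C(N,k) r^(-k) / k! * E_n(r) <= Phi_N(r), and k = sqrt(n/r) is the best choice.

    Lower bound for E_n (lis_mgf_ge): splitting according to the place z where
    the chain leaves the sources, Phi_N(r) is at most twice a sum over z of
    terms that the upper bound already controls. Their exponent is largest at
    z = 0, and only there, so that the terms with z of order N are negligible;
    the others are at most exp(small * sqrt N) * exp(2 sqrt(N/r)) * E_N(r). *)

Set Implicit Arguments.
Unset Strict Implicit.
Unset Printing Implicit Defensive.

Import Order.TTheory GRing.Theory Num.Theory.
Import numFieldNormedType.Exports.

Local Open Scope ring_scope.

(** * Rows of a point configuration crossed by one column *)

(** What is seen of a row just to the right of some column: a horizontal line
    runs in it, or its point lies further right, or its line has already been
    stopped. *)
Notation row_status := (option bool).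
Notation unborn := (Some false).
Notation alive := (Some true).
Notation dead := None.

(** A vertical line that goes up from the bottom row stops, together with the
    first horizontal line that it meets. *)
Fixpoint absorb (t : seq row_status) : seq row_status :=
  if t is x :: t' then
    if x == alive then dead :: t' else x :: absorb t'
  else [::].

(** A point in an unborn row [y] emits a horizontal line, and a vertical one that
    behaves as in [absorb] in the rows above [y]. *)
Fixpoint birth (y : nat) (t : seq row_status) : seq row_status :=
  if t is x :: t' then
    if y is y'.+1 then x :: birth y' t' else alive :: absorb t'
  else [::].

Lemma size_absorb t : size (absorb t) = size t.
Proof. by elim: t => //= x t IH; case: ifP => //= _; rewrite IH. Qed.

Lemma size_birth y t : size (birth y t) = size t.
Proof. by elim: t y => [|x t IH] [|y] //=; rewrite ?size_absorb ?IH. Qed.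

Section SumOverTuples.
Variables (R : nmodType) (T : finType).

Lemma sum_tuple0 (F : seq T -> R) :
  \sum_(t : 0.-tuple T) F t = F [::].
Proof.
by rewrite (big_pred1 [tuple]) // => t; rewrite [t]tuple0 /= eqxx.
Qed.

Lemma sum_tupleS q (F : seq T -> R) :
  \sum_(t : q.+1.-tuple T) F t =
  \sum_(x : T) \sum_(t : q.-tuple T) F (x :: t).
Proof.
rewrite pair_big /= (reindex (fun p : T * q.-tuple T => [tuple of p.1 :: p.2])) //=.
exists (fun t : q.+1.-tuple T => (thead t, [tuple of behead t])) => [[x t] _|t _].
  by congr pair; apply: val_inj.
by rewrite /= [RHS]tuple_eta; apply: val_inj.
Qed.

End SumOverTuples.

Section Burke.
Variable R : comNzRingType.
Implicit Types (V : seq row_status -> R) (g : nat -> R).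

Lemma sum_row_statusS q (F : seq row_status -> R) :
  \sum_(t : q.+1.-tuple row_status) F t =
  \sum_(t : q.-tuple row_status) F (unborn :: t) +
  (\sum_(t : q.-tuple row_status) F (alive :: t) +
   \sum_(t : q.-tuple row_status) F (dead :: t)).
Proof.
rewrite (sum_tupleS q F) (bigD1 dead) //= (bigD1 alive) //= (bigD1 unborn) //=.
by rewrite [X in _ + (_ + (_ + X))]big1 ?addr0; [ring|case=> [[]|]].
Qed.

Definition sum_births V (t : seq row_status) : R :=
  \sum_(y < size t | nth dead t y == unborn) V (birth y t).

Lemma sum_births_cons V x t :
  sum_births V (x :: t) =
  (if x == unborn then V (alive :: absorb t) else 0) +
  sum_births (fun t' => V (x :: t')) t.
Proof. by rewrite /sum_births big_mkcond big_ord_recl /= -big_mkcond. Qed.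

(** A column can be read backwards. Let [t] be the outcome of a column: either its
    vertical line left at the top, or it stopped the line of one of the dead rows
    of [t]; each of these possibilities determines the state before the column and
    the letter that was played, and in the second case that state has one dead row
    less. The induction on the rows is a cell by cell form of this bijection. *)
Lemma burke_column q g V :
  \sum_(t : q.-tuple row_status)
     g (count_mem dead t) * (V (absorb t) + sum_births V t) =
  \sum_(t : q.-tuple row_status)
     (g (count_mem dead t) +
      (count_mem dead t)%:R * g (count_mem dead t).-1) * V t.
Proof.
elim: q g V => [|q IH] g V.
  rewrite (sum_tuple0 (fun t : seq row_status => g (count_mem dead t) * (V (absorb t) + sum_births V t))).
  rewrite (sum_tuple0 (fun t : seq row_status => (g (count_mem dead t) +
      (count_mem dead t)%:R * g (count_mem dead t).-1) * V t)) /=.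
  by rewrite /sum_births big_ord0; ring.
rewrite (sum_row_statusS q (fun t : seq row_status => g (count_mem dead t) * (V (absorb t) + sum_births V t))).
rewrite (sum_row_statusS q (fun t : seq row_status => (g (count_mem dead t) +
      (count_mem dead t)%:R * g (count_mem dead t).-1) * V t)) /=.
under eq_bigr do rewrite sum_births_cons /= add0n.
under [X in _ + (X + _)]eq_bigr do rewrite sum_births_cons /= add0n add0r.
under [X in _ + (_ + X)]eq_bigr do rewrite sum_births_cons /= add1n add0r.
have IHU := IH g (fun t => V (unborn :: t)).
have IHA := IH g (fun t => V (alive :: t)).
have IHD := IH (g \o succn) (fun t => V (dead :: t)).
rewrite /= in IHD.
under [X in _ = _ + (_ + X)]eq_bigr do rewrite add1n /=.
under [X in _ = X + _]eq_bigr do rewrite add0n.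
under [X in _ = _ + (X + _)]eq_bigr do rewrite add0n.
rewrite -IHU -IHA.
have -> : \sum_(t : q.-tuple row_status)
     (g (count_mem dead t).+1 + (count_mem dead t).+1%:R * g (count_mem dead t)) * V (dead :: t)
  = \sum_(t : q.-tuple row_status) g (count_mem dead t).+1 * (V (dead :: absorb t) + sum_births (fun t' => V (dead :: t')) t) + \sum_(t : q.-tuple row_status) g (count_mem dead t) * V (dead :: t).
  rewrite IHD -big_split; apply: eq_bigr => t _ /=.
  case: (count_mem dead t) => [|d] /=; first by ring.
  by rewrite -[d.+2]addn1 natrD; ring.
rewrite -!big_split /=; apply: eq_bigr => t _.
ring.
Qed.
End Burke.

(** * The Burke property for a whole configuration *)

Section Runs.
Variable q : nat.
Implicit Types (t : seq row_status) (w : seq (option 'I_q)).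

Definition step t (x : option 'I_q) : seq row_status :=
  if x is Some y then birth y t else absorb t.

Definition run t w : seq row_status := foldl step t w.

(** [birth] makes sense only in a row whose point is still to come. *)
Fixpoint legal t w : bool :=
  if w is x :: w' then
    (if x is Some y then nth dead t y == unborn else true)
    && legal (step t x) w'
  else true.

Lemma size_step t x : size (step t x) = size t.
Proof. by case: x => [y|]; rewrite /= ?size_absorb ?size_birth. Qed.

Lemma size_run t w : size (run t w) = size t.
Proof. by elim: w t => //= x w IH t; rewrite IH size_step. Qed.

Lemma unborn_absorb t i :
  (nth dead (absorb t) i == unborn) = (nth dead t i == unborn).
Proof. by elim: t i => // x t IH [|i] /=; case: (x =P alive) => [xa|_] /=; rewrite ?xa ?IH. Qed.

Lemma unborn_birth y t i : (y < size t)%N ->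
  (nth dead (birth y t) i == unborn) = (i != y) && (nth dead t i == unborn).
Proof.
elim: t y i => // x t IH [|y] [|i] //= ys; first by rewrite unborn_absorb.
by rewrite IH.
Qed.

Lemma unborn_step t (x : option 'I_q) i : size t = q ->
  (nth dead (step t x) i == unborn) =
  (omap (@nat_of_ord q) x != Some i) && (nth dead t i == unborn).
Proof.
case: x => [y|] /= st; rewrite ?unborn_absorb//.
by rewrite unborn_birth ?st// (inj_eq Some_inj) eq_sym.
Qed.

(** Each row is born once, and a column creates or destroys no other unborn row;
    hence the runs that are legal and end with all points placed are those whose
    letters are the rows unborn at the start, each used once. *)
Lemma legal_runE t w : size t = q ->
  legal t w && (unborn \notin run t w) =
  [forall y : 'I_q, count_mem (Some y) w == (nth dead t y == unborn)].
Proof.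
elim: w t => [|x w IH] t st /=.
  apply/idP/forallP => [tU y|H].
    rewrite eq_sym eqb0; apply: contra tU => /eqP <-.
    by rewrite mem_nth// st.
  apply/(nthP dead) => -[i]; rewrite st => iq ei.
  by have := H (Ordinal iq); rewrite ei eqxx.
rewrite -andbA IH ?size_step//.
case: x => [y|] /=; last first.
  by apply: eq_forallb => i; rewrite unborn_absorb add0n.
apply/andP/forallP => [[ty /forallP H] i|H].
  have := H i; rewrite unborn_birth ?st// (inj_eq Some_inj) [y == i]eq_sym val_eqE.
  by have [->|iy] := eqVneq i y => /= /eqP ->; rewrite ?ty.
have ty : nth dead t y == unborn.
  by have := H y; rewrite eqxx; case: (nth dead t y == unborn).
split=> //; apply/forallP => i; have := H i.
rewrite unborn_birth ?st// (inj_eq Some_inj) [y == i]eq_sym val_eqE.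
by have [->|iy] := eqVneq i y => //=; rewrite ty eqSS.
Qed.

End Runs.

(** The weight of [burke_column] turns the falling factorial of [c] into that of
    [c.+1]: it counts the ways to reach a given state after [c] columns. *)
Lemma ffactS_rec c d : (c.+1 ^_ d = c ^_ d + d * c ^_ d.-1)%N.
Proof.
case: d => [|d] /=; first by rewrite mul0n addn0.
rewrite ffactSS ffactnSr; case: (leqP d c) => dc; last by rewrite ffact_small// !(mul0n, muln0).
by rewrite [(_ * (c - d))%N]mulnC -mulnDl addnS subnK.
Qed.

Section BurkeWords.
Variables (R : comNzRingType) (q : nat).
Implicit Types (V : seq row_status -> R).

Lemma sum_wordS p V (t : q.-tuple row_status) :
  \sum_(w : p.+1.-tuple (option 'I_q) | legal t w) V (run t w) =
  \sum_(w : p.-tuple (option 'I_q) | legal (absorb t) w) V (run (absorb t) w)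
  + sum_births (fun t' => \sum_(w : p.-tuple (option 'I_q) | legal t' w) V (run t' w)) t.
Proof.
rewrite big_mkcond (sum_tupleS p (fun w : seq (option 'I_q) => if legal t w then V (run t w) else 0)).
rewrite (bigD1 None) //= -big_mkcond; congr (_ + _).
rewrite (reindex_omap Some id) /=; last by case.
rewrite /sum_births -(big_mkord (fun y => nth dead t y == unborn)
  (fun y => \sum_(w : p.-tuple (option 'I_q) | legal (birth y t) w) V (run (birth y t) w))).
rewrite size_tuple big_mkord [RHS]big_mkcond.
apply: eq_big => [y|y _]; first by rewrite eqxx.
by case: ifP => ty; [rewrite -big_mkcond | rewrite big1].
Qed.

Lemma burke_words p c V :
  \sum_(t : q.-tuple row_status) (c ^_ (count_mem dead t))%:R *
    \sum_(w : p.-tuple (option 'I_q) | legal t w) V (run t w) =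
  \sum_(t : q.-tuple row_status) ((c + p) ^_ (count_mem dead t))%:R * V t.
Proof.
elim: p c => [|p IH] c.
  rewrite addn0; apply: eq_bigr => t _; rewrite big_mkcond.
  by rewrite (sum_tuple0 (fun w : seq (option 'I_q) => if legal t w then V (run t w) else 0)).
under eq_bigr do rewrite sum_wordS.
rewrite (burke_column q (fun d => (c ^_ d)%:R)) addnS -addSn -IH.
by apply: eq_bigr => t _; rewrite ffactS_rec natrD natrM.
Qed.

(** The rows without a point carry a line from the left border on. *)
Definition input_rows (w : seq (option 'I_q)) : q.-tuple row_status :=
  [tuple if Some y \in w then unborn else alive | y < q].

Definition word_injective (w : seq (option 'I_q)) : bool :=
  [forall y : 'I_q, count_mem (Some y) w <= 1]%N.

(** Burke property: the lines which leave on the right are distributed as those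
    which enter on the left. For [p = q] the right-hand side is, up to the factor
    [q`!], the sum of [r ^+ #|K| / #|K|`!]. *)
Lemma burke_alive p (r : R) :
  \sum_(w : p.-tuple (option 'I_q) | word_injective w)
     r ^+ count_mem alive (run (input_rows w) w) =
  \sum_(K : {set 'I_q}) (p ^_ (q - #|K|))%:R * r ^+ #|K|.
Proof.
(* The weight [0 ^_ d] imposes a start without dead rows, [V] an end without
   unborn ones. *)
pose V t : R := if unborn \in t then 0 else r ^+ count_mem alive t.
transitivity (\sum_(t : q.-tuple row_status) (0 ^_ (count_mem dead t))%:R *
    \sum_(w : p.-tuple (option 'I_q) | legal t w) V (run t w)).
  under [RHS]eq_bigr do rewrite big_distrr big_mkcond /=.
  rewrite exchange_big /= big_mkcond; apply: eq_bigr => w _.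
  rewrite -big_mkcond /=.
  have nthi (t : q.-tuple row_status) (y : 'I_q) : nth dead t y = tnth t y.
    by rewrite (tnth_nth dead).
  case: ifP => [/forallP wi|wi].
    have lw : legal (input_rows w) w && (unborn \notin run (input_rows w) w).
      rewrite legal_runE ?size_tuple//; apply/forallP => y.
      rewrite nthi /= tnth_mktuple.
      have := wi y; rewrite -has_pred1 has_count.
      by case: (count_mem _ _) => [|[|]].
    rewrite (bigD1 (input_rows w)) /=; last first.
      by case/andP: lw.
    rewrite big1 ?addr0 => [|t /andP[tl ti]].
      case/andP: lw => _ /negbTE nU; rewrite /V nU.
      rewrite (_ : count_mem dead _ = 0)%N ?ffactn0 ?mul1r//.
      by apply/count_memPn/mapP => -[y _]; case: ifP.
    rewrite /V; case: ifPn => [_|nU]; first by rewrite mulr0.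
    suff d0 : (0 < count_mem dead t)%N by rewrite ffact_small// mul0r.
    rewrite -has_count has_pred1; apply: contraNT ti => nd.
    have : legal t w && (unborn \notin run t w) by rewrite tl.
    rewrite legal_runE ?size_tuple// => /forallP H.
    apply/eqP/eq_from_tnth => y; rewrite tnth_mktuple.
    have := H y; rewrite nthi -has_pred1 has_count => /eqP ->.
    have : tnth t y != dead by apply: contraNneq nd => <-; exact: mem_tnth.
    by case: (tnth t y) => [[]|].
  rewrite big1 // => t tl; rewrite /V; case: ifPn => [_|nU]; first by rewrite mulr0.
  have : legal t w && (unborn \notin run t w) by rewrite tl.
  rewrite legal_runE ?size_tuple// => /forallP H.
  by case/forallP: wi => y; have /eqP -> := H y; case: (_ == _).
rewrite burke_words add0n.
rewrite (bigID (fun t : q.-tuple row_status => unborn \in t)) /=.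
rewrite big1 ?add0r => [|t tU]; last by rewrite /V tU mulr0.
pose f (K : {set 'I_q}) : q.-tuple row_status := [tuple if y \in K then alive else dead | y < q].
pose f' (t : q.-tuple row_status) : {set 'I_q} := [set y | tnth t y == alive].
rewrite (reindex_onto f f') => [|t tU]; last first.
  apply: eq_from_tnth => y; rewrite tnth_mktuple inE.
  have : tnth t y != unborn by apply: contraNneq tU => <-; exact: mem_tnth.
  by case: (tnth t y) => [[]|].
have ca K : count_mem alive (f K) = #|K|.
  rewrite /f -sum1_count big_tuple; under eq_bigl do rewrite tnth_mktuple.
  by rewrite -sum1_card; apply: eq_bigl => y; case: (y \in K).
have cd K : count_mem dead (f K) = (q - #|K|)%N.
  have -> : (q - #|K|)%N = #|~: K| by have := cardsC K; rewrite card_ord; lia.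
  rewrite /f -sum1_count big_tuple; under eq_bigl do rewrite tnth_mktuple.
  by rewrite -sum1_card; apply: eq_bigl => y; rewrite [in RHS]in_setC; case: (y \in K).
have nU K : (unborn \in f K) = false.
  by apply/mapP => -[y _]; case: ifP.
apply: eq_big => [K|K _]; last by rewrite /V nU ca cd.
rewrite nU /=; apply/eqP/setP => y; rewrite inE tnth_mktuple.
by case: (y \in K).
Qed.

End BurkeWords.

(** * Configurations encoded by permutations *)

Section Words.
Variable N : nat.
Implicit Types (s : 'S_N) (K : {set 'I_N}).

(** The configuration with the points [(c, s c)] for [c] outside [K]; a letter
    [None] is a source at the bottom of an erased column. *)
Definition word s K : N.-tuple (option 'I_N) :=
  [tuple if c \in K then None else Some (s c) | c < N].

Lemma word_injectiveP (w : N.-tuple (option 'I_N)) :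
  reflect (forall c c' y, tnth w c = Some y -> tnth w c' = Some y -> c = c')
          (word_injective w).
Proof.
have cE y : count_mem (Some y) w = #|[set c | tnth w c == Some y]|.
  by rewrite -sum1_count big_tuple -sum1_card; apply: eq_bigl => c; rewrite inE.
apply: (iffP forallP) => [H c c' y wc wc'|H y].
  have := H y; rewrite cE => /card_le1_eqP; apply; rewrite inE; exact/eqP.
by rewrite cE; apply/card_le1_eqP => c c'; rewrite !inE => /eqP a /eqP b; exact: (H _ _ y).
Qed.

Lemma word_is_injective s K : word_injective (word s K).
Proof.
apply/word_injectiveP => c c' y; rewrite !tnth_mktuple.
by case: ifP => // _ [<-]; case: ifP => // _ [/perm_inj].
Qed.

Lemma word_extends (w : N.-tuple (option 'I_N)) : word_injective w ->
  exists s, word s [set c | tnth w c == None] = w.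
Proof.
move=> /word_injectiveP wi.
pose K := [set c | tnth w c == None]; pose S := [set y | Some y \notin w].
have KS : (#|K| <= #|S|)%N.
  have : (#|~: S| <= #|~: K|)%N.
    apply: leq_trans (leq_imset_card (fun c => odflt c (tnth w c)) _).
    apply/subset_leq_card/subsetP => y; rewrite !inE negbK => /tnthP[c yc].
    by apply/imsetP; exists c; rewrite ?inE -yc.
  by have := cardsC K; have := cardsC S; rewrite card_ord; lia.
(* The erased columns are matched with the free rows in increasing order. *)
pose h c := nth c (enum S) (index c (enum K)).
have hK c : c \in K -> (index c (enum K) < size (enum S))%N.
  by move=> cK; rewrite -cardE (leq_trans _ KS)// cardE index_mem mem_enum.
have hS c : c \in K -> h c \in S by move=> cK; rewrite -mem_enum mem_nth ?hK.
have hi c c' : c \in K -> c' \in K -> h c = h c' -> c = c'.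
  move=> cK cK'; rewrite /h (set_nth_default c) ?hK// => /eqP.
  rewrite nth_uniq ?hK ?enum_uniq// => /eqP /(congr1 (nth c (enum K))).
  by rewrite !nth_index ?mem_enum.
pose f c := if tnth w c is Some y then y else h c.
have inK c : (c \in K) = (tnth w c == None) by rewrite inE.
have fi : injective f.
  move=> c c'; rewrite /f; case E: (tnth w c) => [y|]; case E': (tnth w c') => [y'|].
  - by move=> yy; apply: (wi _ _ y); rewrite // yy.
  - move=> yh; have : h c' \in S by rewrite hS// inK E'.
    by rewrite -yh inE -E mem_tnth.
  - move=> yh; have : h c \in S by rewrite hS// inK E.
    by rewrite yh inE -E' mem_tnth.
  - by apply: hi; rewrite inK ?E ?E'.
exists (perm fi); apply: eq_from_tnth => c; rewrite tnth_mktuple permE /f inE.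
by case: (tnth w c) => [y|].
Qed.

(** The values of the permutation on the erased columns are free: two permutations
    with the same configuration differ by a permutation of these columns. *)
Lemma card_word_fibre (w : N.-tuple (option 'I_N)) :
  word_injective w ->
  #|[set s | word s [set c | tnth w c == None] == w]| =
  (#|[set c | tnth w c == None]|)`!.
Proof.
move=> wi; have [s0 ws0] := word_extends wi.
set K := [set c | tnth w c == None] in ws0 *.
rewrite -card_perm -(card_imset (perm_on K) (mulIg s0)); apply: eq_card => s; rewrite inE.
have E : (word s K == w) = [forall c, (c \notin K) ==> (s c == s0 c)].
  rewrite -{1}ws0; apply/eqP/forallP => [ww c|H].
    have := congr1 (fun w => tnth w c) ww; rewrite !tnth_mktuple.
    by case: ifP => //= _ [->].
  apply: eq_from_tnth => c; rewrite !tnth_mktuple.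
  by have := H c; case: ifP => //= _ /eqP ->.
rewrite {}E; apply/forallP/imsetP => [H|[u uK ->] c].
  exists (s * s0^-1)%g; last by rewrite mulgKV.
  apply/subsetP => c; rewrite inE permM; apply: contraR => cK.
  by have := H c; rewrite cK /= => /eqP ->; rewrite permK.
by apply/implyP => cK; rewrite permM (out_perm uK cK).
Qed.

Lemma sum_words (R : numFieldType) (G : seq (option 'I_N) -> R) :
  \sum_(w : N.-tuple (option 'I_N) | word_injective w) G w =
  \sum_(s : 'S_N) \sum_(K : {set 'I_N}) ((#|K|)`!%:R)^-1 * G (word s K).
Proof.
rewrite pair_big /=.
rewrite (partition_big (fun p => word p.1 p.2)
  (fun w : N.-tuple (option 'I_N) => word_injective w)) /=; last first.
  by move=> p _; exact: word_is_injective.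
apply: eq_bigr => w wi.
set K0 := [set c | tnth w c == None].
have KE s K : word s K = w -> K = K0.
  by move=> wE; apply/setP => c; rewrite inE -wE tnth_mktuple; case: ifP.
transitivity (\sum_(s | word s K0 == w) ((#|K0|)`!%:R)^-1 * G w).
  have := card_word_fibre wi; rewrite -/K0 cardsE => cw.
  rewrite sumr_const cw -[RHS]mulr_natl mulrA divff ?mul1r//.
rewrite [RHS](eq_bigr (fun p => ((#|K0|)`!%:R)^-1 * G w)); last first.
  by move=> [s K] /= /eqP wE; rewrite -[in RHS]wE (KE _ _ wE).
rewrite [RHS](reindex_onto (fun s => (s, K0)) (fun p => p.1)) /=.
  by apply: eq_bigl => s; rewrite eqxx andbT.
by move=> [s K] /= /eqP /KE ->.
Qed.

End Words.

(** * Counting lines measures increasing chains *)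

Definition Lmax_in N (s : 'S_N) (M : {set 'I_N}) : nat :=
  (\max_(A : {set 'I_N} | (A \subset M) && increasing_on s A) #|A|)%N.

Definition alive_below (y : nat) (t : seq row_status) : nat :=
  count_mem alive (take y t).

Lemma alive_below_absorb y t : alive_below y (absorb t) = (alive_below y t).-1.
Proof.
rewrite /alive_below; elim: t y => [|x t IH] [|y] /=; rewrite ?take0 //.
by case: (boolP (x == alive)) => [_|/negbTE nx] /=; rewrite ?nx ?add0n ?IH.
Qed.

(** With [alive_below_absorb], this is the recursion of longest chains: a chain that
    ends below row [y] either avoids the new point, or consists of that point after
    a longest chain below it. *)
Lemma alive_below_birth y0 y t : (y0 < size t)%N -> nth dead t y0 != alive ->
  alive_below y (birth y0 t) =
  if (y <= y0)%N then alive_below y t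
  else maxn (alive_below y t) (alive_below y0 t).+1.
Proof.
rewrite /alive_below; elim: t y0 y => [|x t IH] [|y0] [|y] /=; rewrite ?take0 //.
  move=> _ /negbTE ->; have := alive_below_absorb y t.
  rewrite /alive_below => -> /=; rewrite add0n.
  by move: (count _ _) => n; lia.
by rewrite !ltnS => ys nx; rewrite IH//; case: ifP => _ //; rewrite -addnS addn_maxr.
Qed.

Lemma unborn_run q (t : seq row_status) (w : seq (option 'I_q)) (y : 'I_q) :
  size t = q ->
  (nth dead (run t w) y == unborn) =
  (Some y \notin w) && (nth dead t y == unborn).
Proof.
elim: w t => //= x w IH t st; rewrite IH ?size_step// unborn_step// in_cons.
rewrite negb_or andbCA !andbA; congr (_ && _ && _); rewrite eq_sym.
by case: x => [z|] //; rewrite !(inj_eq Some_inj) val_eqE eq_sym.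
Qed.

Lemma count_take_enum N (T : Type) (f : 'I_N -> T) (a : pred T) y :
  count a (take y [seq f i | i <- enum 'I_N]) =
  #|[set i : 'I_N | (i < y)%N && a (f i)]|.
Proof.
rewrite -map_take count_map -size_filter.
set u := (X in size X); have uu : uniq u by rewrite filter_uniq// take_uniq// enum_uniq.
rewrite -(card_uniqP uu) cardsE; apply: eq_card => i.
rewrite mem_filter in_take ?mem_enum// index_enum_ord andbC.
by rewrite inE.
Qed.

Section LineCount.
Variables (N : nat) (s : 'S_N) (K : {set 'I_N}).
Let w := word s K.

Definition rows_at (c : nat) : seq row_status := run (input_rows w) (take c w).

(** The number of lines crossed by an increasing path from the corner of the array
    to column [c] and row [y], first along the bottom and then upwards. *)
Definition line_count (c y : nat) : nat :=
  (count_mem None (take c w) + alive_below y (rows_at c))%N.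

Lemma size_rows_at c : size (rows_at c) = N.
Proof. by rewrite size_run size_tuple. Qed.

Lemma sources_before c :
  count_mem None (take c w) = #|[set k in K | (k < c)%N]|.
Proof.
rewrite count_take_enum; apply: eq_card => k; rewrite !inE andbC.
by case: (k \in K).
Qed.

Lemma line_count_col0 y :
  line_count 0 y = #|[set k in K | (s k < y)%N]|.
Proof.
rewrite /line_count /rows_at take0 /= add0n /alive_below count_take_enum.
rewrite -[RHS](card_imset _ (@perm_inj _ s)); apply: eq_card => r; rewrite inE.
apply/andP/imsetP => [[ry]|[k]].
  case: ifP => // rw _; exists ((s^-1)%g r); rewrite ?permKV// inE permKV ry andbT.
  apply: contraFT rw => rK; apply/mapP; exists ((s^-1)%g r).
    by rewrite mem_enum.
  by rewrite (negbTE rK) permKV.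
rewrite inE => /andP[kK ky ->]; split=> //; case: ifP => // /mapP[c _].
by case: ifPn => // cK [/perm_inj kc]; rewrite -kc kK in cK.
Qed.

Lemma line_count_row0 c : line_count c 0 = #|[set k in K | (k < c)%N]|.
Proof. by rewrite /line_count sources_before /alive_below take0 addn0. Qed.

Lemma line_count_final :
  line_count N N = (#|K| + count_mem alive (run (input_rows w) w))%N.
Proof.
rewrite /line_count sources_before /alive_below /rows_at.
rewrite (take_oversize (n := N) (s := w)) ?size_tuple//.
rewrite take_oversize ?size_run ?size_tuple//.
by congr (_ + _)%N; apply: eq_card => k; rewrite inE ltn_ord andbT.
Qed.

Lemma take_wordS (c : 'I_N) : take c.+1 w = rcons (take c w) (tnth w c).
Proof. by rewrite (take_nth None) ?size_tuple// -tnth_nth. Qed.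

Lemma rows_atS (c : 'I_N) : rows_at c.+1 = step (rows_at c) (tnth w c).
Proof. by rewrite /rows_at take_wordS /run foldl_rcons. Qed.

Lemma line_count_source (c : 'I_N) y : c \in K ->
  line_count c.+1 y = maxn (line_count c y) (line_count c 0).+1.
Proof.
move=> cK; rewrite /line_count rows_atS take_wordS -cats1 count_cat.
rewrite tnth_mktuple cK /= alive_below_absorb {3}/alive_below take0 /=.
by lia.
Qed.

Lemma line_count_point (c : 'I_N) y : c \notin K ->
  line_count c.+1 y =
  if (y <= s c)%N then line_count c y
  else maxn (line_count c y) (line_count c (s c)).+1.
Proof.
move=> cK; rewrite /line_count rows_atS take_wordS -cats1 count_cat.
have wc : tnth w c = Some (s c) by rewrite tnth_mktuple (negbTE cK).
rewrite wc /= alive_below_birth ?size_rows_at//; first by case: ifP => _; lia.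
suff : nth dead (rows_at c) (s c) == unborn by move/eqP ->.
rewrite unborn_run ?size_tuple//; apply/andP; split.
  apply/(nthP None) => -[i]; rewrite size_take size_tuple ltn_ord => ic.
  rewrite nth_take// => wi.
  have iN : (i < N)%N by exact: ltn_trans (ltn_ord c).
  have /word_injectiveP := word_is_injective s K.
  move=> /(_ (Ordinal iN) c (s c)); rewrite wc (tnth_nth None) /= => /(_ wi erefl) ec.
  by move: ic; rewrite -ec /= ltnn.
by rewrite -tnth_nth tnth_mktuple -wc mem_tnth.
Qed.

(** By induction on the columns: if the last column holds a point of the chain,
    the rest of the chain is counted below that point. *)
Lemma increasing_le_line_count c y (A : {set 'I_N}) : (c <= N)%N ->
  A \subset ~: K -> increasing_on s A ->
  (forall i, i \in A -> (i < c)%N && (s i < y)%N) -> (#|A| <= line_count c y)%N.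
Proof.
elim: c y A => [|c IH] y A cN AK incA Ac.
  by rewrite (_ : A = set0) ?cards0//; apply/setP => i; rewrite inE; apply/negP => /Ac.
pose d := Ordinal cN.
have [dA|dA] := boolP (d \in A); last first.
  have : (#|A| <= line_count c y)%N.
    apply: IH => //; first exact: ltnW.
    move=> i iA; have /andP[ic ->] := Ac i iA; rewrite andbT.
    by rewrite ltn_neqAle -ltnS ic andbT; apply: contraNneq dA => di; rewrite (_ : d = i)//; apply: val_inj.
  have [dK|dK] := boolP (d \in K).
    by rewrite (line_count_source y dK) => h; rewrite leq_max h.
  by rewrite (line_count_point y dK) => h; case: ifP => // _; rewrite leq_max h.
have dK : d \notin K by have := subsetP AK _ dA; rewrite inE.
have /andP[_ dy] := Ac d dA.
rewrite (line_count_point y dK) [(y <= s d)%N]leqNgt dy /= leq_max; apply/orP; right.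
rewrite (cardsD1 d) dA add1n ltnS; apply: IH; first exact: ltnW.
- exact: subset_trans (subsetDl _ _) AK.
- apply/forall_inP => i; rewrite !inE => /andP[_ iA].
  apply/forall_inP => j; rewrite !inE => /andP[_ jA].
  by move/forall_inP/(_ i iA)/forall_inP/(_ j jA): incA.
- move=> i; rewrite !inE => /andP[id iA].
  have ic : (i < d)%N.
    have /andP[ic _] := Ac i iA; rewrite /= ltn_neqAle -ltnS ic andbT.
    by apply: contraNneq id => ie; apply/eqP/val_inj.
  rewrite ic /=; move/forall_inP/(_ i iA)/forall_inP/(_ d dA)/implyP: incA; exact.
Qed.

(** A longest chain is followed backwards through the recursions
    [line_count_source] and [line_count_point]; it reaches either a bottom source
    in some column before [z], or the left border at height [z], and there the
    count is the number of sources passed. *)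
Lemma line_count_exit c y : (c <= N)%N ->
  exists (z : nat) (A : {set 'I_N}), [/\ A \subset ~: K, increasing_on s A,
    forall i, i \in A -> (i < c)%N && (s i < y)%N &
    [/\ (z <= c)%N, forall i, i \in A -> (z <= i)%N &
       (line_count c y <= #|[set k in K | (k < z)%N]| + #|A|)%N] \/
    [/\ (z <= y)%N, forall i, i \in A -> (z <= s i)%N &
       (line_count c y <= #|[set k in K | (s k < z)%N]| + #|A|)%N]].
Proof.
have inc0 : increasing_on s set0 by apply/forall_inP => i; rewrite inE.
elim: c y => [|c IH] y cN.
  (* At the left border the chain consists of the left sources below row [y]. *)
  exists y, set0; split=> //; rewrite ?sub0set//; first by move=> i; rewrite inE.
  by right; rewrite line_count_col0 cards0 addn0; split=> // i; rewrite inE.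
pose d := Ordinal cN; have cN' := ltnW cN.
have keep : line_count c.+1 y = line_count c y ->
    exists (z : nat) (A : {set 'I_N}), [/\ A \subset ~: K, increasing_on s A,
    forall i, i \in A -> (i < c.+1)%N && (s i < y)%N &
    [/\ (z <= c.+1)%N, forall i, i \in A -> (z <= i)%N &
       (line_count c.+1 y <= #|[set k in K | (k < z)%N]| + #|A|)%N] \/
    [/\ (z <= y)%N, forall i, i \in A -> (z <= s i)%N &
       (line_count c.+1 y <= #|[set k in K | (s k < z)%N]| + #|A|)%N]].
  move=> ->; have [z [A [AK incA Ac zA]]] := IH y cN'; exists z, A; split=> //.
    by move=> i /Ac /andP[ic ->]; rewrite andbT ltnS ltnW.
  by case: zA => -[zc zA lA]; [left; split=> //; exact: leqW|right].
have [dK|dK] := boolP (d \in K).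
  have := line_count_source y dK; rewrite /=.
  have [_ e|_ e] := leqP (line_count c 0).+1 (line_count c y); first exact: keep.
  exists c.+1, set0; split=> //; rewrite ?sub0set//; first by move=> i; rewrite inE.
  left; split=> //; first by move=> i; rewrite inE.
  rewrite e line_count_row0 cards0 addn0 (cardsD1 d [set k in K | (k < c.+1)%N]).
  rewrite inE dK /= ltnSn add1n ltnS; apply/subset_leq_card/subsetP => k.
  rewrite !inE => /andP[kK kc]; rewrite kK ltnS (ltnW kc) !andbT.
  by apply: contraTneq kc => ->; rewrite /= ltnn.
have := line_count_point y dK; rewrite /=.
case: leqP => [_|dy]; first exact: keep.
have [_ e|_ e] := leqP (line_count c (s d)).+1 (line_count c y); first exact: keep.
have [z [A [AK incA Ac zA]]] := IH (s d) cN'.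
have dA : d \notin A by apply/negP => /Ac; rewrite /= ltnn.
have AdK : d |: A \subset ~: K by rewrite subUset sub1set inE dK.
have incAd : increasing_on s (d |: A).
  apply/forall_inP => i iA; apply/forall_inP => j jA; apply/implyP => ij.
  move: iA jA; rewrite !inE => /orP[/eqP ei|iA] /orP[/eqP ej|jA].
  - by move: ij; rewrite ei ej ltnn.
  - by have /andP[jc _] := Ac j jA; move: ij; rewrite ei /= ltnNge (ltnW jc).
  - by rewrite ej; have /andP[] := Ac i iA.
  - by move/forall_inP/(_ i iA)/forall_inP/(_ j jA)/implyP: incA; apply.
have Adc i : i \in d |: A -> (i < c.+1)%N && (s i < y)%N.
  rewrite !inE => /orP[/eqP ->|/Ac /andP[ic iy]]; first by rewrite /= ltnSn.
  by rewrite ltnS (ltnW ic) (ltn_trans iy dy).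
exists z, (d |: A); split=> //; case: zA => -[zc zA lA]; [left|right].
  split=> //; first exact: leqW.
    by move=> i; rewrite !inE => /orP[/eqP ->|/zA].
  by rewrite e cardsU1 dA add1n addnS ltnS.
split=> //; first exact: leq_trans zc (ltnW dy).
  by move=> i; rewrite !inE => /orP[/eqP ->|/zA].
by rewrite e cardsU1 dA add1n addnS ltnS.
Qed.

End LineCount.

(** * Two inequalities for the moments of the longest increasing subsequence *)

Lemma increasing_onP n (s : 'S_n) (A : {set 'I_n}) :
  reflect (forall i j, i \in A -> j \in A -> (i < j)%N -> (s i < s j)%N)
          (increasing_on s A).
Proof.
apply: (iffP forall_inP) => [H i j iA jA ij|H i iA].
  by have /forall_inP/(_ j jA)/implyP := H i iA; exact.
by apply/forall_inP => j jA; apply/implyP; exact: H.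
Qed.

Lemma Lmax_in_ge n (s : 'S_n) (M A : {set 'I_n}) :
  A \subset M -> increasing_on s A -> (#|A| <= Lmax_in s M)%N.
Proof.
by move=> AM iA; rewrite /Lmax_in (bigop.bigmax_sup A)// AM.
Qed.

Lemma Lmax_in_setT n (s : 'S_n) : Lmax_in s [set: 'I_n] = Lmax s.
Proof. by apply: eq_bigl => A; rewrite finset.subsetT. Qed.

Lemma Lmax_in_sub n (s : 'S_n) (M M' : {set 'I_n}) :
  M \subset M' -> (Lmax_in s M <= Lmax_in s M')%N.
Proof.
move=> MM'; apply/bigmax_leqP => A /andP[AM iA].
by apply: Lmax_in_ge => //; exact: subset_trans MM'.
Qed.

Lemma Lmax_in_inv n (s : 'S_n) (M : {set 'I_n}) :
  Lmax_in (s^-1)%g (s @: M) = Lmax_in s M.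
Proof.
have le (t : 'S_n) (X : {set 'I_n}) : (Lmax_in t X <= Lmax_in (t^-1)%g (t @: X))%N.
  apply/bigmax_leqP => A /andP[AX /increasing_onP iA].
  rewrite -(card_imset _ (@perm_inj _ t)); apply: Lmax_in_ge; first exact: imsetS.
  apply/increasing_onP => _ _ /imsetP[i iiA ->] /imsetP[j jA ->]; rewrite !permK.
  case: (ltngtP i j) => // [ji|/val_inj ->]; last by rewrite ltnn.
  by have := iA _ _ jA iiA ji; case: ltngtP.
apply/eqP; rewrite eqn_leq le andbT.
have E : (s^-1)%g @: (s @: M) = M.
  rewrite -imset_comp -[RHS]imset_id; apply: eq_imset => i /=; exact: permK.
by have := le (s^-1)%g (s @: M); rewrite invgK E.
Qed.

Lemma ltn_bump2 h i j : (bump h i < bump h j)%N = (i < j)%N.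
Proof. by rewrite !ltnNge leq_bump2. Qed.

(** Removing a column, and the row of its point, does not change the relative order
    of the remaining points. *)
Lemma Lmax_in_lift n (i j : 'I_n.+1) (s : 'S_n) (M : {set 'I_n.+1}) : i \notin M ->
  Lmax_in (lift_perm i j s) M = Lmax_in s (lift i @^-1: M).
Proof.
move=> iM; apply/eqP; rewrite eqn_leq; apply/andP; split.
  apply/bigmax_leqP => A /andP[AM /increasing_onP iA].
  have -> : A = lift i @: (lift i @^-1: A).
    apply/setP => k; apply/idP/imsetP => [kA|[k' + ->]]; last by rewrite inE.
    case: (unliftP i k) kA => [k' ->|->] kA; first by exists k'; rewrite ?inE.
    by move: iM; rewrite (subsetP AM _ kA).
  rewrite card_imset; last exact: lift_inj.
  apply: Lmax_in_ge; first exact: preimsetS.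
  apply/increasing_onP => a b; rewrite !inE => aA bA ab.
  by have := iA _ _ aA bA; rewrite !lift_perm_lift /= !ltn_bump2; apply.
apply/bigmax_leqP => A /andP[AM /increasing_onP iA].
rewrite -(card_imset _ (@lift_inj _ i)); apply: Lmax_in_ge.
  by apply/subsetP => _ /imsetP[k kA ->]; have := subsetP AM _ kA; rewrite inE.
apply/increasing_onP => _ _ /imsetP[a aA ->] /imsetP[b bA ->].
by rewrite !lift_perm_lift /= !ltn_bump2; exact: iA.
Qed.

Lemma sum_lift_perm (R : nmodType) n (i : 'I_n.+1) (G : 'S_n.+1 -> R) :
  \sum_(s : 'S_n.+1) G s =
  \sum_(j : 'I_n.+1) \sum_(s : 'S_n) G (lift_perm i j s).
Proof.
rewrite pair_big /= (reindex (fun p : 'I_n.+1 * 'S_n => lift_perm i p.1 p.2))//.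
apply: onW_bij; apply: inj_card_bij; last first.
  by rewrite card_prod !card_Sn card_ord factS.
move=> [j s] [j' s'] /= /permP E.
have jj : j = j' by have := E i; rewrite !lift_perm_id.
congr pair => //; apply/permP => k; apply: (@lift_inj _ j).
by have := E (lift i k); rewrite !lift_perm_lift -jj.
Qed.

Section MomentSums.
Variable R : realFieldType.

Definition mean_perm n (F : 'S_n -> R) : R := (n`!%:R)^-1 * \sum_(s : 'S_n) F s.

Definition lis_mgf (r : R) (n : nat) : R := mean_perm (fun s : 'S_n => r ^+ Lmax s).

(** The relative order of a uniform permutation restricted to [m] positions is that
    of a uniform permutation of [m] letters. The positions outside [M] are removed
    one at a time. *)
Lemma mean_Lmax_in n m (M : {set 'I_n}) (F : nat -> R) : #|M| = m ->
  mean_perm (fun s : 'S_n => F (Lmax_in s M)) = mean_perm (fun s : 'S_m => F (Lmax s)).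
Proof.
elim: n M => [|n IH] M Mm.
  move: (Mm); have -> : M = [set: 'I_0] by apply/setP => -[].
  rewrite cardsT card_ord => <-.
  by congr (_ * _); apply: eq_bigr => s _; rewrite Lmax_in_setT.
have [MT|] := eqVneq M [set: 'I_n.+1].
  move: Mm; rewrite {}MT cardsT card_ord => <-.
  by congr (_ * _); apply: eq_bigr => s _; rewrite Lmax_in_setT.
rewrite -properT => /properP[_ [i _ iM]].
rewrite -(IH (lift i @^-1: M)); last first.
  rewrite -Mm -(card_imset _ (@lift_inj _ i)); apply: eq_card => k.
  apply/imsetP/idP => [[k' + ->]|kM]; first by rewrite inE.
  case: (unliftP i k) kM => [k' ->|->] kM; first by exists k'; rewrite ?inE.
  by rewrite kM in iM.
rewrite /mean_perm (sum_lift_perm i).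
under eq_bigr do under eq_bigr do rewrite Lmax_in_lift//.
rewrite sumr_const card_ord factS natrM -[X in _ * X]mulr_natl.
rewrite invfM mulrA [_^-1 * _^-1]mulrC -mulrA mulrA; congr (_ * _).
by rewrite -mulrA mulVf ?mulr1// pnatr_eq0.
Qed.

(** The weighted generating function of the number of sources on either side. *)
Definition boundary_sum (N : nat) (r : R) : R :=
  \sum_(K : {set 'I_N}) (((#|K|)`!)%:R)^-1 * r ^+ #|K|.

Definition alive_final N (s : 'S_N) (K : {set 'I_N}) : nat :=
  count_mem alive (run (input_rows (word s K)) (word s K)).

Lemma mean_alive_final N (r : R) :
  mean_perm (fun s : 'S_N =>
    \sum_(K : {set 'I_N}) (((#|K|)`!)%:R)^-1 * r ^+ alive_final s K) =
  boundary_sum N r.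
Proof.
rewrite /mean_perm -(sum_words (fun w => r ^+ count_mem alive (run (input_rows w) w))).
rewrite burke_alive big_distrr /=; apply: eq_bigr => K _; rewrite mulrA; congr (_ * _).
have KN : (#|K| <= N)%N by rewrite -[X in (_ <= X)%N]card_ord max_card.
have := @ffact_fact N (N - #|K|)%N; rewrite leq_subr subKn// => /(_ isT) e.
apply: (@mulIf _ (#|K|)`!%:R); first by rewrite pnatr_eq0 -lt0n fact_gt0.
rewrite mulVf ?pnatr_eq0 -?lt0n ?fact_gt0// -mulrA -natrM e mulVf//.
Qed.


Lemma alive_final_ge N (s : 'S_N) (K : {set 'I_N}) :
  (Lmax_in s (~: K) <= #|K| + alive_final s K)%N.
Proof.
apply/bigmax_leqP => A /andP[AK iA]; rewrite /alive_final -line_count_final.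
by apply: increasing_le_line_count => // i _; rewrite !ltn_ord.
Qed.

Definition tail_set n (z : nat) (K : {set 'I_n}) : {set 'I_n} := [set k in K | (z <= k)%N].

Lemma card_tail_set n z (K : {set 'I_n}) :
  #|K| = (#|[set k in K | (k < z)%N]| + #|tail_set z K|)%N.
Proof.
rewrite -(cardsID [set k : 'I_n | (k < z)%N] K); congr (_ + _)%N; apply: eq_card => k.
  by rewrite !inE.
by rewrite !inE -leqNgt andbC.
Qed.

(** The first alternative is a chain that starts with bottom sources, the second
    one that starts with left sources. The second is the first one for the array
    reflected in the diagonal, that is for [s^-1] and the erased set [s @: K]. *)
Lemma alive_final_le N (s : 'S_N) (K : {set 'I_N}) :
  exists2 z, (z <= N)%N &
    (alive_final s K + #|tail_set z K| <= Lmax_in s (tail_set z (~: K)))%N \/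
    (alive_final s K + #|tail_set z (s @: K)| <=
       Lmax_in (s^-1)%g (tail_set z (~: (s @: K))))%N.
Proof.
have [z [A [AK iA _ H]]] := line_count_exit s K N (leqnn N).
case: H => -[zN zA]; rewrite line_count_final -/(alive_final s K) => le; exists z => //; [left|right].
  have : (#|A| <= Lmax_in s (tail_set z (~: K)))%N.
    apply: Lmax_in_ge => //; apply/subsetP => i iA'; rewrite inE (zA i iA') andbT.
    exact: (subsetP AK).
  by move: le; rewrite (card_tail_set z); lia.
have sK : #|[set k in s @: K | (k < z)%N]| = #|[set k in K | (s k < z)%N]|.
  rewrite -[RHS](card_imset _ (@perm_inj _ s)); apply: eq_card => k.
  rewrite inE; apply/andP/imsetP => [[/imsetP[c cK ->] cz]|[c]].
    by exists c; rewrite // inE cK.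
  by rewrite inE => /andP[cK cz ->]; rewrite imset_f.
have : (#|A| <= Lmax_in (s^-1)%g (tail_set z (~: (s @: K))))%N.
  have h : (#|A| <= Lmax_in s A)%N by exact: Lmax_in_ge.
  rewrite -(Lmax_in_inv s A) in h; apply: leq_trans h _; apply: Lmax_in_sub.
  apply/subsetP => _ /imsetP[i iA' ->]; rewrite !inE zA// andbT.
  by rewrite mem_imset ?(subsetP AK)//; [have := subsetP AK _ iA'; rewrite inE|exact: perm_inj].
have := card_imset K (@perm_inj _ s); rewrite (card_tail_set z (s @: K)) sK.
by move: le; lia.
Qed.

Lemma mean_perm_le n (F G : 'S_n -> R) :
  (forall s, F s <= G s) -> mean_perm F <= mean_perm G.
Proof.
by move=> FG; rewrite ler_wpM2l ?invr_ge0 ?ler0n//; apply: ler_sum => s _.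
Qed.

Lemma mean_perm_sum n (I : finType) (F : I -> 'S_n -> R) :
  mean_perm (fun s => \sum_i F i s) = \sum_i mean_perm (F i).
Proof. by rewrite /mean_perm exchange_big mulr_sumr. Qed.

Lemma mean_permZ n (a : R) (F : 'S_n -> R) :
  mean_perm (fun s => a * F s) = a * mean_perm F.
Proof. by rewrite /mean_perm -mulr_sumr mulrCA. Qed.

Lemma mean_permD n (F G : 'S_n -> R) :
  mean_perm (fun s => F s + G s) = mean_perm F + mean_perm G.
Proof. by rewrite /mean_perm big_split mulrDr. Qed.

Lemma mean_perm_inv n (F : 'S_n -> R) :
  mean_perm (fun s => F (s^-1)%g) = mean_perm F.
Proof. by rewrite /mean_perm [in RHS](reindex_inj invg_inj). Qed.

Lemma sum_lis_mgf_le_boundary N (r : R) : 1 <= r ->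
  \sum_(K : {set 'I_N}) (((#|K|)`!)%:R)^-1 * r^-1 ^+ #|K| * lis_mgf r (N - #|K|)
  <= boundary_sum N r.
Proof.
move=> r1; have r0 : 0 < r by exact: lt_le_trans r1.
rewrite -mean_alive_final mean_perm_sum; apply: ler_sum => K _.
rewrite /lis_mgf -(@mean_Lmax_in N _ (~: K) (fun l => r ^+ l)); last first.
  by have := cardsC K; rewrite card_ord; lia.
rewrite -mean_permZ; apply: mean_perm_le => s; rewrite -mulrA.
rewrite ler_wpM2l ?invr_ge0 ?ler0n// exprVn ler_pdivrMl ?exprn_gt0//.
by rewrite -exprD ler_weXn2l// alive_final_ge.
Qed.

(** The contribution to [boundary_sum] of the chains that leave the bottom sources at
    column [z]: the factor [r] that each source before [z] adds to the
    chain cancels its weight [r^-1], and only the sources further right keep theirs. *)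
Definition exit_sum N (r : R) (z : nat) : R :=
  \sum_(K : {set 'I_N})
    (((#|K|)`!)%:R)^-1 * (r^-1 ^+ #|tail_set z K| * lis_mgf r #|tail_set z (~: K)|).

(** Reflection in the diagonal exchanges the two alternatives of
    [alive_final_le], whence the factor 2. *)
Lemma boundary_sum_le N (r : R) : 1 <= r ->
  boundary_sum N r <= 2 * \sum_(z < N.+1) exit_sum N r z.
Proof.
move=> r1; have r0 : 0 < r by exact: lt_le_trans r1.
pose T (z : nat) (s : 'S_N) (K : {set 'I_N}) : R :=
  (((#|K|)`!)%:R)^-1 * (r^-1 ^+ #|tail_set z K| * r ^+ Lmax_in s (tail_set z (~: K))).
have T0 z s K : 0 <= T z s K.
  by rewrite !mulr_ge0 ?invr_ge0 ?ler0n// exprn_ge0// ?invr_ge0 ltW.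
have ET z : mean_perm (fun s => \sum_K T z s K) = exit_sum N r z.
  rewrite mean_perm_sum; apply: eq_bigr => K _; rewrite /T !mean_permZ.
  by rewrite (@mean_Lmax_in N _ _ (fun l => r ^+ l) erefl).
have ET' z : mean_perm (fun s => \sum_(K : {set 'I_N}) T z (s^-1)%g (s @: K)) = exit_sum N r z.
  rewrite -ET -[RHS]mean_perm_inv; congr (_ * _); apply: eq_bigr => s _.
  rewrite [RHS](reindex (fun K : {set 'I_N} => s @: K))//.
  apply: onW_bij; exists (fun K : {set 'I_N} => (s^-1)%g @: K) => K.
    by rewrite -imset_comp -[RHS]imset_id; apply: eq_imset => i /=; exact: permK.
  by rewrite -imset_comp -[RHS]imset_id; apply: eq_imset => i /=; exact: permKV.
have -> : 2 * \sum_(z < N.+1) exit_sum N r z =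
    mean_perm (fun s => \sum_(K : {set 'I_N}) \sum_(z < N.+1)
      (T z s K + T z (s^-1)%g (s @: K))).
  under [in RHS]eq_fun do rewrite exchange_big.
  rewrite mean_perm_sum mulr_sumr; apply: eq_bigr => z _.
  under [in RHS]eq_fun do rewrite big_split.
  by rewrite mean_permD ET ET' mulr_natl mulr2n.
rewrite -mean_alive_final; apply: mean_perm_le => s; apply: ler_sum => K _.
have [z zN H] := alive_final_le s K.
rewrite (bigD1 (Ordinal (n:=N.+1) (m:=z) zN)) //= ler_wpDr//.
  by apply: sumr_ge0 => i _; rewrite addr_ge0.
have main (a b c : nat) : (a + b <= c)%N -> r ^+ a <= r^-1 ^+ b * r ^+ c.
  by move=> h; rewrite exprVn ler_pdivlMl ?exprn_gt0// -exprD ler_weXn2l// addnC.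
case: H => H; [rewrite ler_wpDr//|rewrite ler_wpDl//].
  by rewrite ler_wpM2l ?invr_ge0 ?ler0n// main.
rewrite /T card_imset; last exact: perm_inj.
by rewrite ler_wpM2l ?invr_ge0 ?ler0n// main.
Qed.

End MomentSums.

(** * Upper bound for the moments *)

Section MomentBounds.
Variable R : realType.
Implicit Types (q th x : R) (N n k z : nat).

Lemma expR_ge_pow (x : R) k : 0 <= x -> x ^+ k / k`!%:R <= expR x.
Proof.
move=> x0; case: k => [|k].
  by rewrite expr0 fact0 divr1 -expR0 ler_expR.
by apply: le_trans (expR_ge1Dxn k x0); rewrite ler_wpDl.
Qed.

(** A crude Stirling bound is enough, since polynomial factors are invisible at the
    scale [exp (sqrt n)]. The step is [exp (1 / (k + 1)) <= 1 + 1 / k]. *)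
Lemma fact_le_stirling k : (0 < k)%N ->
  k`!%:R * expR 1 ^+ k <= expR 1 * k%:R ^+ k.+1 :> R.
Proof.
elim: k => // -[_ _|k IH _].
  by rewrite (_ : 1`! = 1)%N// mul1r expr1 expr1n mulr1.
set m := k.+1 in IH *.
have m0 : (0 : R) < m%:R by rewrite ltr0n.
have step : expR 1 * m%:R ^+ m.+1 <= m.+1%:R ^+ m.+1 :> R.
  have -> : expR 1 = expR (m.+1%:R^-1) ^+ m.+1 :> R.
    by rewrite -expRM_natl divff// pnatr_eq0.
  rewrite -exprMn lerXn2r ?nnegrE ?mulr_ge0 ?expR_ge0 ?ler0n//.
  have M0 : (0 : R) < m.+1%:R by rewrite ltr0n.
  have e1 := expR_ge1Dx (- (m.+1%:R^-1) : R).
  have mE : 1 + - m.+1%:R^-1 = m%:R / m.+1%:R :> R.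
    rewrite -[in RHS](_ : m.+1%:R - 1 = m%:R :> R); last by rewrite -natr1 addrK.
    by rewrite mulrBl mul1r divff// gt_eqF.
  have : m%:R / m.+1%:R * expR (m.+1%:R^-1) <= 1 :> R.
    rewrite -mE (le_trans (ler_wpM2r (expR_ge0 _) e1))//.
    by rewrite -expRD addNr expR0.
  by rewrite mulrAC ler_pdivrMr// mul1r mulrC.
rewrite factS natrM exprS.
have := IH isT; rewrite -/m => h.
have -> : m.+1%:R * m`!%:R * (expR 1 * expR 1 ^+ m) = m.+1%:R * expR 1 * (m`!%:R * expR 1 ^+ m) :> R by ring.
apply: (@le_trans _ _ (m.+1%:R * expR 1 * (expR 1 * m%:R ^+ m.+1))).
  by rewrite ler_wpM2l// mulr_ge0 ?expR_ge0.
by rewrite [_ * expR 1]mulrC -!mulrA ler_wpM2l ?expR_ge0// [leRHS]exprS ler_wpM2l.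
Qed.

(** Bounding [1 / k!] by [exp th / th ^ k] decouples the elements of [K], and the
    sum becomes a product. The best [th] is the square root of the sum of the
    weights; keeping it free avoids this square root. *)
Lemma sum_subsets_le N (x : 'I_N -> R) th :
  (forall c, 0 <= x c) -> 0 < th ->
  \sum_(K : {set 'I_N}) (((#|K|)`!)%:R)^-1 * \prod_(c in K) x c
    <= expR (th + (\sum_c x c) / th).
Proof.
move=> x0 th0.
apply: (@le_trans _ _ (\sum_(K : {set 'I_N}) expR th * \prod_(c in K) (x c / th))).
  apply: ler_sum => K _; rewrite big_split /= prodr_const mulrCA.
  have p0 : 0 <= \prod_(c in K) x c by apply: prodr_ge0.
  rewrite [leLHS]mulrC ler_wpM2l// exprVn ler_pdivlMr ?exprn_gt0// mulrC.
  exact: expR_ge_pow (ltW th0).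
rewrite -mulr_sumr expRD ler_wpM2l ?expR_ge0// mulr_suml expR_sum.
have -> : \sum_(K : {set 'I_N}) \prod_(c in K) (x c / th) = \prod_c (x c / th + 1).
  rewrite bigA_distr; apply: eq_bigr => K _; rewrite big_mkcond /=.
  by apply: eq_bigr => c _; case: ifP.
apply: ler_prod => c _; rewrite addrC expR_ge1Dx andbT.
by rewrite addr_ge0 ?divr_ge0 ?x0 // ltW.
Qed.

Lemma boundary_sum_le_exp N (r th : R) : 0 <= r -> 0 < th ->
  boundary_sum N r <= expR (th + N%:R * r / th).
Proof.
move=> r0 th0; have := @sum_subsets_le N (fun=> r) th (fun=> r0) th0.
rewrite sumr_const card_ord -[r *+ N]mulr_natl => h; apply: le_trans h.
by apply: ler_sum => K _; rewrite prodr_const.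
Qed.

Lemma sum_sets_card N k (F : nat -> R) :
  \sum_(K : {set 'I_N} | #|K| == k) F #|K| = 'C(N, k)%:R * F k.
Proof.
rewrite (eq_bigr (fun=> F k)) => [|K /eqP -> //].
by rewrite sumr_const -cardsE card_draws card_ord mulr_natl.
Qed.

Lemma sum_sets_ge N k (F : nat -> R) : (forall i, 0 <= F i) ->
  'C(N, k)%:R * F k <= \sum_(K : {set 'I_N}) F #|K|.
Proof.
move=> F0; rewrite -sum_sets_card [leRHS](bigID (fun K : {set 'I_N} => #|K| == k)) /=.
by rewrite ler_wpDr// sumr_ge0.
Qed.

Lemma lis_mgf_ge0 (r : R) n : 0 <= r -> 0 <= lis_mgf r n.
Proof.
move=> r0; rewrite mulr_ge0 ?invr_ge0 ?ler0n// sumr_ge0// => s _.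
exact: exprn_ge0.
Qed.

Lemma ffact_ge_exp n k : (n ^ k <= (n + k) ^_ k)%N.
Proof.
elim: k => [|k IH]; first by rewrite ffactn0.
by rewrite addnS ffactSS expnS leq_mul// leqW// leq_addr.
Qed.

Lemma ffact_ge_exp_sub n k : (k <= n)%N -> ((n - k) ^ k <= n ^_ k)%N.
Proof. by move=> kn; have := ffact_ge_exp (n - k) k; rewrite subnK. Qed.

Lemma stirling_sqr k : (0 < k)%N ->
  (k`!%:R) ^+ 2 <= expR (2 - 2 * k%:R) * k%:R ^+ 2 * (k%:R ^+ 2) ^+ k :> R.
Proof.
move=> k0; have h := fact_le_stirling k0.
have e0 : 0 < expR 1 ^+ k :> R by rewrite exprn_gt0 ?expR_gt0.
have h2 : k`!%:R <= expR (1 - k%:R) * k%:R ^+ k.+1 :> R.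
  rewrite -(ler_pM2r e0) (le_trans h)// -expRM_natl mulr1.
  by rewrite mulrAC -expRD subrK.
apply: (@le_trans _ _ ((expR (1 - k%:R) * k%:R ^+ k.+1) ^+ 2)).
  by rewrite lerXn2r ?nnegrE ?ler0n ?mulr_ge0 ?expR_ge0 ?exprn_ge0.
rewrite exprMn -expRM_natl -!exprM -mulrA -exprD mulrBr mulr1.
have -> : (k.+1 * 2 = 2 + 2 * k)%N by lia.
exact: lexx.
Qed.

(** The last exponent is, up to a bounded error, [2 q sqrt N - 2 k] for [N = n + k]
    and [k] close to [sqrt n / q]. *)
Lemma lis_mgf_le q n : 1 <= q ->
  lis_mgf (q ^+ 2) n <= expR 5 * n.+1%:R * expR (2 * (q - q^-1) * Num.sqrt n%:R).
Proof.
move=> q1; have q0 : 0 < q by exact: lt_le_trans q1.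
have r1 : 1 <= q ^+ 2 by exact: exprn_ege1.
have r0 : 0 < q ^+ 2 by exact: lt_le_trans r1.
set a := Num.sqrt n%:R; have a0 : 0 <= a by exact: sqrtr_ge0.
have a2 : a ^+ 2 = n%:R by rewrite sqr_sqrtr ?ler0n.
pose k := Num.truncn (a / q).
have /andP[ka ak] : k%:R <= a / q < k.+1%:R by apply: truncn_itv; rewrite divr_ge0 // ltW.
have kqa : k%:R * q <= a by rewrite -ler_pdivlMr.
have aqk : a < (k%:R + 1) * q by rewrite natr1 -ltr_pdivrMr.
have k0 : (0 : R) <= k%:R by rewrite ler0n.
have main th : 0 < th -> lis_mgf (q ^+ 2) n * 'C(n + k, k)%:R <=
    k`!%:R * (q ^+ 2) ^+ k * expR (th + (n + k)%:R * q ^+ 2 / th).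
  move=> th0.
  pose T i : R := (i`!%:R)^-1 * (q ^+ 2)^-1 ^+ i * lis_mgf (q ^+ 2) (n + k - i).
  have T0 i : 0 <= T i.
    rewrite mulr_ge0 ?lis_mgf_ge0 ?(ltW r0)// mulr_ge0 ?invr_ge0 ?ler0n//.
    by rewrite exprn_ge0// invr_ge0 ltW.
  have h := le_trans (le_trans (sum_sets_ge (n + k) k T0) (sum_lis_mgf_le_boundary (n + k) r1))
    (boundary_sum_le_exp (n + k) (ltW r0) th0).
  have f0 : 0 < k`!%:R * (q ^+ 2) ^+ k by rewrite mulr_gt0 ?exprn_gt0// ltr0n fact_gt0.
  rewrite mulrC -ler_pdivrMl// (le_trans _ h)// le_eqVlt; apply/orP; left; apply/eqP.
  by rewrite /T addnK exprVn invfM; ring.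
have bound x y : lis_mgf (q ^+ 2) n <= x * expR y -> x <= n.+1%:R -> 0 <= x ->
    y <= 5 + 2 * (q - q^-1) * a ->
    lis_mgf (q ^+ 2) n <= expR 5 * n.+1%:R * expR (2 * (q - q^-1) * a).
  move=> h xn x0 ya; apply: le_trans h _; rewrite [expR 5 * _]mulrC -[leRHS]mulrA -expRD.
  by apply: ler_pM; rewrite ?expR_ge0 ?ler_expR.
have qa : 2 * (q - q^-1) * a = 2 * q * a - 2 * (a / q) by ring.
(* The parameter [th = q * a] used below is positive only for [n > 0]. *)
have [n0|n0] := posnP n.
  have az : a = 0 by rewrite /a n0 sqrtr0.
  have k00 : k = 0%N by rewrite /k az mul0r truncn0.
  have h := main 1 ltr01.
  rewrite k00 n0 bin0 fact0 expr0 !(mulr1, mul1r, mulr0n, mul0r, divr1, addr0) in h.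
  have {}h : lis_mgf (q ^+ 2) n <= 1 * expR 1 by rewrite n0 mul1r.
  by apply: (bound _ _ h); rewrite ?ler1n// az mulr0 addr0 ler1n.
have ap : 0 < a by rewrite sqrtr_gt0 ltr0n.
have thE : q * a + (n + k)%:R * q ^+ 2 / (q * a) = 2 * q * a + k%:R * q / a.
  by rewrite natrD -a2; field; rewrite !gt_eqF.
have := main (q * a) (mulr_gt0 q0 ap); rewrite {}thE => {}main.
have [k00|kp] := posnP k.
  rewrite k00 bin0 fact0 expr0 !(mulr1, mul1r, mulr0n, mul0r, divr1, addr0) in main.
  apply: (bound 1 (2 * q * a)); rewrite ?mul1r ?ler1n// qa.
  by move: ak; rewrite k00; lra.
have kR : (0 : R) < k%:R by rewrite ltr0n.
have kqa1 : k%:R * q / a <= 1 by rewrite ler_pdivrMr// mul1r.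
have ka2 : (k%:R * q) ^+ 2 <= n%:R.
  by rewrite -a2 lerXn2r ?nnegrE// mulr_ge0// ltW.
have k2n : k%:R ^+ 2 <= n%:R :> R.
  apply: le_trans ka2; rewrite exprMn ler_peMr// exprn_ge0//.
apply: (bound (k%:R ^+ 2) (3 - 2 * k%:R + 2 * q * a)); last first.
- by rewrite qa; move: ak; rewrite -natr1; lra.
- exact: exprn_ge0.
- by rewrite (le_trans k2n)// ler_nat.
have nk0 : (0 : R) < n%:R ^+ k by rewrite exprn_gt0// ltr0n.
rewrite -(ler_pM2r nk0).
have nk : n%:R ^+ k <= 'C(n + k, k)%:R * k`!%:R :> R.
  by rewrite -natrM bin_ffact -natrX ler_nat ffact_ge_exp.
have m0 := lis_mgf_ge0 n (ltW r0).
apply: (le_trans (ler_wpM2l m0 nk)); rewrite mulrA.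
apply: (le_trans (ler_wpM2r (ler0n _ _) main)).
have -> : k`!%:R * (q ^+ 2) ^+ k * expR (2 * q * a + k%:R * q / a) * k`!%:R =
  k`!%:R ^+ 2 * ((q ^+ 2) ^+ k * expR (2 * q * a + k%:R * q / a)) :> R by ring.
have P0 : 0 <= (q ^+ 2) ^+ k * expR (2 * q * a + k%:R * q / a).
  by rewrite mulr_ge0 ?expR_ge0// exprn_ge0// ltW.
apply: (le_trans (ler_wpM2r P0 (stirling_sqr kp))).
have -> : expR (2 - 2 * k%:R) * k%:R ^+ 2 * (k%:R ^+ 2) ^+ k *
    ((q ^+ 2) ^+ k * expR (2 * q * a + k%:R * q / a)) =
  (k%:R ^+ 2 * expR (2 - 2 * k%:R + (2 * q * a + k%:R * q / a))) * ((k%:R * q) ^+ 2) ^+ k.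
  rewrite [in RHS]expRD.
  have -> : ((k%:R * q) ^+ 2) ^+ k = (k%:R ^+ 2) ^+ k * (q ^+ 2) ^+ k by rewrite -!exprMn.
  by ring.
apply: ler_pM.
- by rewrite mulr_ge0 ?expR_ge0 ?exprn_ge0.
- by rewrite !exprn_ge0// mulr_ge0// ltW.
- by rewrite ler_wpM2l ?exprn_ge0// ler_expR; lra.
- by rewrite lerXn2r ?nnegrE ?exprn_ge0 ?mulr_ge0 ?ler0n// ltW.
Qed.

End MomentBounds.

(** * Ingredients of the lower bound for the moments *)

Section MomentLowerBound.
Variable R : realType.
Implicit Types (q th x : R) (N n k z : nat).

(** A single term of the sum is kept, the largest one: sets of size about
    [q sqrt N]. *)
Lemma boundary_sum_ge q N : 1 <= q -> 4 * q ^+ 2 <= N%:R ->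
  expR (2 * q * Num.sqrt N%:R - 4 - 2 * q ^+ 2) <=
    q ^+ 2 * N%:R * boundary_sum N (q ^+ 2).
Proof.
move=> q1 qN; have q0 : 0 < q by exact: lt_le_trans q1.
have r1 : 1 <= q ^+ 2 by exact: exprn_ege1.
have r0 : 0 < q ^+ 2 by exact: lt_le_trans r1.
have N0 : (0 : R) < N%:R by apply: lt_le_trans qN; rewrite mulr_gt0.
set a := Num.sqrt N%:R; have a0 : 0 < a by rewrite sqrtr_gt0.
have a2 : a ^+ 2 = N%:R by rewrite sqr_sqrtr ?ler0n.
have a1 : 1 <= a by rewrite -sqrtr1 ler_wsqrtr//; lra.
pose k := Num.truncn (q * a).
have /andP[ka ak] : k%:R <= q * a < k.+1%:R by apply: truncn_itv; rewrite mulr_ge0// ltW.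
have kp : (0 < k)%N by rewrite truncn_gt0 -[1]mulr1 ler_pM.
have kR : (0 : R) < k%:R by rewrite ltr0n.
have k2 : k%:R ^+ 2 <= q ^+ 2 * N%:R :> R.
  by rewrite -a2 -exprMn lerXn2r ?nnegrE ?ler0n// mulr_ge0// ltW.
have kN : 2 * k%:R <= N%:R :> R.
  rewrite -(@ler_pXn2r _ 2) ?nnegrE ?mulr_ge0 ?ler0n// exprMn.
  apply: (@le_trans _ _ (2 ^+ 2 * (q ^+ 2 * N%:R))); first by rewrite ler_wpM2l.
  by rewrite mulrA [leRHS]expr2 ler_wpM2r ?ler0n//; apply: le_trans qN; rewrite -natrX.
have kN' : (k <= N)%N by rewrite -(ler_nat R); lra.
pose T i : R := (i`!%:R)^-1 * (q ^+ 2) ^+ i.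
have T0 i : 0 <= T i by rewrite mulr_ge0 ?invr_ge0 ?ler0n// exprn_ge0// ltW.
have h1 : 'C(N, k)%:R * T k <= boundary_sum N (q ^+ 2) by exact: sum_sets_ge.
have kf0 : (0 : R) < k`!%:R by rewrite ltr0n fact_gt0.
have B0 : 0 <= boundary_sum N (q ^+ 2).
  by apply: sumr_ge0 => K _; exact: T0.
have h2 : ((N - k)%N%:R * q ^+ 2) ^+ k <= boundary_sum N (q ^+ 2) * k`!%:R ^+ 2.
  apply: le_trans (ler_wpM2r (exprn_ge0 2 (ltW kf0)) h1).
  have -> : 'C(N, k)%:R * T k * k`!%:R ^+ 2 = ('C(N, k) * k`!)%N%:R * (q ^+ 2) ^+ k.
    by rewrite natrM /T; field; rewrite gt_eqF.
  rewrite exprMn; apply: ler_wpM2r; first exact: exprn_ge0 (ltW r0).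
  by rewrite bin_ffact -natrX ler_nat ffact_ge_exp_sub.
have h3 : k%:R ^+ 2 * expR (- (2 * k%:R / N%:R)) <= (N - k)%N%:R * q ^+ 2.
  have e1 : expR (- (2 * k%:R / N%:R)) <= 1 - k%:R / N%:R :> R.
    have x0 : 0 <= k%:R / N%:R :> R by rewrite divr_ge0 ?ler0n.
    have x1 : k%:R / N%:R <= 1/2 :> R by rewrite ler_pdivrMr//; lra.
    rewrite -mulrA; move: (k%:R / N%:R) x0 x1 => x x0 x1.
    have E0 := expR_gt0 (2 * x); have E1 := expR_ge1Dx (2 * x).
    by rewrite expRN -(ler_pM2r E0) mulVf ?gt_eqF//; nra.
  apply: (@le_trans _ _ (q ^+ 2 * N%:R * (1 - k%:R / N%:R))).
    by apply: ler_pM; rewrite ?expR_ge0 ?exprn_ge0 ?ler0n.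
  rewrite natrB// le_eqVlt; apply/orP; left; apply/eqP; field.
  by rewrite gt_eqF.
have h4 : (k%:R ^+ 2) ^+ k * expR (- (2 * q ^+ 2)) <= ((N - k)%N%:R * q ^+ 2) ^+ k.
  have h : 0 <= k%:R ^+ 2 * expR (- (2 * k%:R / N%:R)) :> R.
    by rewrite mulr_ge0 ?expR_ge0 ?exprn_ge0.
  have h' : 0 <= (N - k)%N%:R * q ^+ 2 := le_trans h h3.
  apply: (@le_trans _ _ ((k%:R ^+ 2 * expR (- (2 * k%:R / N%:R))) ^+ k)); last first.
    by rewrite lerXn2r.
  rewrite [leRHS]exprMn -expRM_natl; apply: ler_wpM2l; first by rewrite !exprn_ge0.
  rewrite ler_expR mulrN lerN2.
  have -> : k%:R * (2 * k%:R / N%:R) = 2 * (k%:R ^+ 2 / N%:R) :> R by rewrite expr2; ring.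
  by rewrite ler_wpM2l// ler_pdivrMr.
have h5 := le_trans h4 (le_trans h2 (ler_wpM2l B0 (@stirling_sqr R k kp))).
have kk0 : (0 : R) < (k%:R ^+ 2) ^+ k by rewrite !exprn_gt0.
have h6 : expR (- (2 * q ^+ 2)) <= boundary_sum N (q ^+ 2) * (expR (2 - 2 * k%:R) * k%:R ^+ 2).
  by rewrite -(ler_pM2l kk0) (le_trans h5)// le_eqVlt; apply/orP; left; apply/eqP; ring.
apply: (@le_trans _ _ (expR (- (2 * q ^+ 2)) * expR (2 * k%:R - 2))).
  by rewrite -expRD ler_expR; move: ak; rewrite -natr1; lra.
apply: (le_trans (ler_wpM2r (expR_ge0 _) h6)).
have -> : boundary_sum N (q ^+ 2) * (expR (2 - 2 * k%:R) * k%:R ^+ 2) * expR (2 * k%:R - 2) =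
   k%:R ^+ 2 * boundary_sum N (q ^+ 2) * (expR (2 - 2 * k%:R) * expR (2 * k%:R - 2)) by ring.
rewrite -expRD (_ : 2 - 2 * k%:R + (2 * k%:R - 2) = 0); last by ring.
by rewrite expR0 mulr1 ler_wpM2r.
Qed.

Lemma lis_mgf_mono (r : R) n m : 1 <= r -> (n <= m)%N -> lis_mgf r n <= lis_mgf r m.
Proof.
move=> r1 nm.
have := @mean_Lmax_in R m n [set widen_ord nm i | i in [set: 'I_n]] (fun l => r ^+ l).
rewrite card_imset ?cardsT ?card_ord; last by move=> i j /(congr1 val) /= /val_inj.
move=> /(_ erefl) e; rewrite /lis_mgf -e; apply: mean_perm_le => s.
by rewrite ler_weXn2l// -Lmax_in_setT Lmax_in_sub// finset.subsetT.
Qed.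

Lemma card_tail_set_le N z (K : {set 'I_N}) : (#|tail_set z K| <= N - z)%N.
Proof.
have [Nz|zN] := leqP N z.
  rewrite (_ : tail_set z K = set0) ?cards0//; apply/setP => i; rewrite !inE.
  by rewrite [(z <= i)%N]leqNgt (leq_trans (ltn_ord i) Nz) andbF.
have := card_tail_set z [set: 'I_N]; rewrite cardsT card_ord.
have -> : #|[set k in [set: 'I_N] | (k < z)%N]| = z.
  rewrite -sum1_card; under eq_bigl do rewrite !inE /=.
  by rewrite (big_ord_narrow (ltnW zN)) sum1_card card_ord.
move=> e; have -> : (N - z)%N = #|tail_set z [set: 'I_N]| by rewrite [in LHS]e addKn.
by apply/subset_leq_card/subsetP => i; rewrite !inE => /andP[_ ->].
Qed.

(** The sum over [K] is of the form treated in [sum_subsets_le], with weight 1 for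
    the columns before [z] and [q^-2] for the others. *)
Lemma exit_sum_le N z q th (B : R) : (z <= N)%N -> 0 < q -> 0 < th ->
  (forall K : {set 'I_N}, lis_mgf (q ^+ 2) #|tail_set z (~: K)| <= B) ->
  exit_sum N (q ^+ 2) z <= expR (th + (z%:R + (N - z)%N%:R / q ^+ 2) / th) * B.
Proof.
move=> zN q0 th0 HB.
have r0 : 0 < q ^+ 2 by exact: exprn_gt0.
have B0 : 0 <= B by apply: le_trans (HB setT); rewrite lis_mgf_ge0// ltW.
pose x (c : 'I_N) : R := if (z <= c)%N then (q ^+ 2)^-1 else 1.
have x0 c : 0 <= x c by rewrite /x; case: ifP => // _; rewrite invr_ge0 ltW.
have xE : \sum_c x c = z%:R + (N - z)%N%:R / q ^+ 2.
  rewrite /x -(big_mkord xpredT (fun c => if (z <= c)%N then (q ^+ 2)^-1 else 1)).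
  rewrite (big_cat_nat (n := z))//=; congr (_ + _).
    under eq_big_nat => c /andP[_ cz] do rewrite leqNgt cz /=.
    by rewrite sumr_const_nat subn0.
  under eq_big_nat => c /andP[zc _] do rewrite zc.
  by rewrite sumr_const_nat mulr_natl.
rewrite -xE; apply: le_trans (ler_wpM2r B0 (sum_subsets_le x0 th0)).
rewrite mulr_suml; apply: ler_sum => K _; rewrite -mulrA.
rewrite ler_wpM2l ?invr_ge0 ?ler0n//.
have -> : \prod_(c in K) x c = (q ^+ 2)^-1 ^+ #|tail_set z K|.
  rewrite /x -big_mkcondr /= -prodr_const; apply: eq_bigl => c.
  by rewrite !inE.
by rewrite ler_wpM2l// exprn_ge0// invr_ge0 ltW.
Qed.
End MomentLowerBound.

(** * Lower bound for the moments *)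

Section MomentAsymptotics.
Variable R : realType.
Implicit Types (q e x : R) (N n z : nat).

Lemma poly_le_expR_sqrt (C e : R) : 0 < e ->
  \forall n \near \oo%classic, C * n.+1%:R ^+ 3 <= expR (e * Num.sqrt n%:R).
Proof.
move=> e0.
have [D D0 DE] : exists2 D : R, 0 < D & D = (2 * 4)`!%:R.
  by exists (2 * 4)`!%:R; rewrite // ltr0n fact_gt0.
near=> n.
have n1 : (0 : R) < n%:R by rewrite ltr0n; near: n; exact: nbhs_infty_gt.
(* The term of degree 8 of the exponential is of order [n ^+ 4]. *)
have h := @expR_ge_pow R (e * Num.sqrt n%:R) 8 (mulr_ge0 (ltW e0) (sqrtr_ge0 _)).
apply: le_trans h; rewrite exprMn -[8%N]/(2 * 4)%N (exprM (Num.sqrt _)) sqr_sqrtr ?ler0n//.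
rewrite -DE ler_pdivlMr//.
have e8 : 0 < e ^+ (2 * 4) by rewrite exprn_gt0.
have [C0|C0] := leP C 0.
  apply: (@le_trans _ _ 0); last by rewrite mulr_ge0 ?exprn_ge0 ?ler0n// ltW.
  by rewrite !mulr_le0_ge0 // ?exprn_ge0 ?ltW.
have nb : 8 * C * D / e ^+ (2 * 4) <= n%:R by near: n; exact: nbhs_infty_ger.
rewrite ler_pdivrMr// in nb.
have n2 : n.+1%:R ^+ 3 <= 8 * n%:R ^+ 3 :> R.
  have -> : 8 * n%:R ^+ 3 = (2 * n%:R) ^+ 3 :> R by ring.
  rewrite lerXn2r ?nnegrE ?mulr_ge0 ?ler0n// -natr1.
  suff : 1 <= n%:R :> R by lra.
  by rewrite ler1n -(ltr0n R).
apply: (@le_trans _ _ (8 * C * D * n%:R ^+ 3)).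
  have -> : C * n.+1%:R ^+ 3 * D = C * D * n.+1%:R ^+ 3 by ring.
  have -> : 8 * C * D * n%:R ^+ 3 = C * D * (8 * n%:R ^+ 3) by ring.
  by rewrite ler_wpM2l// mulr_ge0// ltW.
have -> : e ^+ (2 * 4) * n%:R ^+ 4 = (n%:R * e ^+ (2 * 4)) * n%:R ^+ 3 by rewrite [n%:R ^+ 4]exprS; ring.
by rewrite ler_wpM2r// exprn_ge0// ler0n.
Unshelve. all: by end_near. Qed.

(** The first term serves for the far exits [z > d N], the second one for the near
    exits. With [a = sqrt N] and [b = sqrt (N - z)], the choice [th = a / q] makes
    the exponent of a far exit [2 q a - (q - q^-1) (a - b)^2 / a], a perfect square
    below the exponent [2 q a] of [boundary_sum]. *)
Lemma exit_sum_le_mixed N z q d : (0 < N)%N -> (z <= N)%N -> 1 <= q -> 0 <= d ->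
  exit_sum N (q ^+ 2) z <=
    expR 5 * N.+1%:R *
      expR ((2 * q - (q - q^-1) * d ^+ 2 / 4) * Num.sqrt N%:R) +
    expR ((2 * q^-1 + q * d) * Num.sqrt N%:R) * lis_mgf (q ^+ 2) N.
Proof.
move=> N0 zN q1 d0; set a := Num.sqrt N%:R; have q0 : 0 < q by exact: lt_le_trans q1.
have r1 : 1 <= q ^+ 2 by exact: exprn_ege1.
have a0 : 0 < a by rewrite sqrtr_gt0 ltr0n.
have a2 : a ^+ 2 = N%:R by rewrite sqr_sqrtr ?ler0n.
have mN0 := lis_mgf_ge0 N (le_trans ler01 r1).
have g0 : 0 <= q - q^-1 by rewrite subr_ge0 (le_trans _ q1)// invf_le1.
have aq0 : 0 < a / q by exact: divr_gt0.
have z0 : (0 : R) <= z%:R by rewrite ler0n.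
have [zd|dz] := leP z%:R (d * N%:R).
  rewrite ler_wpDl// ?mulr_ge0 ?expR_ge0//.
  have B (K : {set 'I_N}) : lis_mgf (q ^+ 2) #|tail_set z (~: K)| <= lis_mgf (q ^+ 2) N.
    by rewrite lis_mgf_mono// (leq_trans (card_tail_set_le _ _))// leq_subr.
  apply: (le_trans (exit_sum_le zN q0 aq0 B)); rewrite ler_wpM2r// ler_expR.
  have -> : a / q + (z%:R + (N - z)%N%:R / q ^+ 2) / (a / q) =
     2 * q^-1 * a + (q - q^-1) * (z%:R / a).
    by rewrite natrB// -a2; field; rewrite !gt_eqF.
  have za : z%:R / a <= d * a by rewrite ler_pdivrMr// -mulrA -expr2 a2.
  rewrite [leRHS]mulrDl lerD2l; apply: (@le_trans _ _ (q * (z%:R / a))).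
    by rewrite ler_wpM2r ?divr_ge0// ?(ltW a0)// lerBlDr lerDl invr_ge0 ltW.
  by rewrite -mulrA ler_wpM2l// ltW.
apply: ler_wpDr; first by rewrite mulr_ge0 ?expR_ge0.
pose b : R := Num.sqrt (N - z)%N%:R.
have b0 : 0 <= b by exact: sqrtr_ge0.
have b2 : b ^+ 2 = N%:R - z%:R by rewrite sqr_sqrtr ?ler0n// natrB.
have B (K : {set 'I_N}) : lis_mgf (q ^+ 2) #|tail_set z (~: K)| <=
     expR 5 * N.+1%:R * expR (2 * (q - q^-1) * b).
  apply: (le_trans (lis_mgf_mono r1 (card_tail_set_le _ _))).
  apply: (le_trans (lis_mgf_le _ q1)); rewrite ler_wpM2r ?expR_ge0//.
  by rewrite ler_wpM2l ?expR_ge0// ler_nat ltnS leq_subr.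
apply: (le_trans (exit_sum_le zN q0 aq0 B)).
rewrite mulrCA; apply: ler_wpM2l; first by rewrite mulr_ge0 ?expR_ge0.
rewrite -expRD ler_expR.
have -> : a / q + (z%:R + (N - z)%N%:R / q ^+ 2) / (a / q) + 2 * (q - q^-1) * b =
  2 * q * a - (q - q^-1) * ((a - b) ^+ 2 / a).
  have -> : (N - z)%N%:R = b ^+ 2 by rewrite b2 natrB.
  have -> : z%:R = a ^+ 2 - b ^+ 2 by rewrite a2 b2 opprB addrCA subrr addr0.
  by field; rewrite !gt_eqF.
have ba : b <= a by rewrite ler_wsqrtr// ler_nat leq_subr.
have ab : d * a / 2 <= a - b.
  (* Since [a + b <= 2 a], the difference [a - b] is at least [z / (2 a)]. *)
  have h : (a - b) * (a + b) = z%:R by rewrite -subr_sqr a2 b2 opprB addrCA subrr addr0.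
  have h2 : d * a ^+ 2 <= (a - b) * (2 * a).
    rewrite a2 (le_trans (ltW dz))// -h ler_wpM2l ?subr_ge0//; lra.
  rewrite -(ler_pM2r a0); nra.
have d2 : d ^+ 2 / 4 * a <= (a - b) ^+ 2 / a.
  rewrite ler_pdivlMr//.
  have -> : d ^+ 2 / 4 * a * a = (d * a / 2) ^+ 2 by field.
  by rewrite lerXn2r ?nnegrE ?subr_ge0// divr_ge0// mulr_ge0// ltW.
have := ler_wpM2l g0 d2; lra.
Qed.

(** The slope [d] is chosen so that the near exits cost only [exp (e sqrt n / 2)];
    the far exits then lose a factor [exp (eta sqrt n)], which beats all the
    polynomial factors. *)
Lemma lis_mgf_ge q e : 1 < q -> 0 < e ->
  \forall n \near \oo%classic,
    expR ((2 * (q - q^-1) - e) * Num.sqrt n%:R) <= lis_mgf (q ^+ 2) n.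
Proof.
move=> q1 e0; have q1' := ltW q1; have q0 : 0 < q by exact: lt_trans q1.
have r1 : 1 <= q ^+ 2 by exact: exprn_ege1.
have g0 : 0 < q - q^-1 by rewrite subr_gt0 (lt_trans _ q1)// invf_lt1.
pose d := e / (2 * q); have d0 : 0 < d by rewrite divr_gt0// mulr_gt0.
pose eta := (q - q^-1) * d ^+ 2 / 4.
have eta0 : 0 < eta by rewrite divr_gt0// mulr_gt0// exprn_gt0.
(* One constant large enough for both comparisons below. *)
pose C := 4 * q ^+ 2 * expR (9 + 2 * q ^+ 2).
near=> n.
have n0 : (0 < n)%N by near: n; exact: nbhs_infty_gt.
have nq : 4 * q ^+ 2 <= n%:R by near: n; exact: nbhs_infty_ger.
have P1 : C * n.+1%:R ^+ 3 <= expR (eta * Num.sqrt n%:R).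
  by near: n; exact: poly_le_expR_sqrt.
have P2 : C * n.+1%:R ^+ 3 <= expR (e / 2 * Num.sqrt n%:R).
  by near: n; apply: poly_le_expR_sqrt; exact: divr_gt0.
set a := Num.sqrt n%:R in P1 P2 *.
pose X := expR 5 * n.+1%:R * expR ((2 * q - eta) * a).
pose m := lis_mgf (q ^+ 2) n.
have m0 : 0 <= m by rewrite lis_mgf_ge0// (le_trans ler01).
have qd : q * d = e / 2 by rewrite /d; field; rewrite gt_eqF.
have lo := boundary_sum_ge q1' nq.
have up := boundary_sum_le n r1.
have up' : \sum_(z < n.+1) exit_sum n (q ^+ 2) z <=
   n.+1%:R * (X + expR ((2 * q^-1 + e / 2) * a) * m).
  rewrite mulr_natl -[X in _ *+ X]card_ord -sumr_const; apply: ler_sum => z _.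
  have zn : (z <= n)%N by rewrite -ltnS.
  by have := exit_sum_le_mixed n0 zn q1' (ltW d0); rewrite qd.
have qn0 : 0 <= q ^+ 2 * n%:R by rewrite mulr_ge0 ?ler0n// ltW// exprn_gt0.
have h := le_trans lo (ler_wpM2l qn0 (le_trans up (ler_wpM2l (ler0n _ 2) up'))).
rewrite -/a in h.
pose Y := expR (2 * q * a - 4 - 2 * q ^+ 2).
pose D := q ^+ 2 * n%:R * (2 * n.+1%:R).
have Dn : D <= 2 * q ^+ 2 * n.+1%:R ^+ 2.
  have -> : 2 * q ^+ 2 * n.+1%:R ^+ 2 = q ^+ 2 * n.+1%:R * (2 * n.+1%:R) by ring.
  by rewrite ler_wpM2r ?mulr_ge0// ler_wpM2l ?ler_nat// ltW// exprn_gt0.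
have D0 : 0 < D by rewrite !mulr_gt0 ?exprn_gt0 ?ltr0n.
have nn1 : (1 : R) <= n.+1%:R by rewrite ler1n.
have DX : D * X <= Y / 2.
  have -> : Y = expR (-4 - 2 * q ^+ 2) * expR ((2 * q - eta) * a) * expR (eta * a).
    by rewrite -!expRD; congr expR; ring.
  apply: (@le_trans _ _ (expR (-4 - 2 * q ^+ 2) * expR ((2 * q - eta) * a) * (C * n.+1%:R ^+ 3) / 2)); last first.
    by rewrite ler_wpM2r// ler_wpM2l// mulr_ge0 ?expR_ge0.
  have CE : expR (-4 - 2 * q ^+ 2) * C = 4 * q ^+ 2 * expR 5.
    rewrite /C mulrCA -expRD; congr (_ * expR _); ring.
  have -> : expR (-4 - 2 * q ^+ 2) * expR ((2 * q - eta) * a) * (C * n.+1%:R ^+ 3) / 2 =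
    (expR (-4 - 2 * q ^+ 2) * C) * expR ((2 * q - eta) * a) * n.+1%:R ^+ 3 / 2 by ring.
  rewrite CE.
  have -> : 4 * q ^+ 2 * expR 5 * expR ((2 * q - eta) * a) * n.+1%:R ^+ 3 / 2 =
    2 * q ^+ 2 * n.+1%:R ^+ 2 * X by rewrite /X; field.
  by rewrite ler_wpM2r// /X !mulr_ge0 ?expR_ge0.
have Ym : Y / 2 <= D * (expR ((2 * q^-1 + e / 2) * a) * m).
  have : Y <= D * X + D * (expR ((2 * q^-1 + e / 2) * a) * m).
    by apply: (le_trans h); rewrite /D le_eqVlt; apply/orP; left; apply/eqP; ring.
  lra.
have E0 : 0 < expR (e / 2 * a) by exact: expR_gt0.
have De : 2 * D * expR (4 + 2 * q ^+ 2) <= expR (e / 2 * a).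
  apply: le_trans P2.
  apply: (@le_trans _ _ (2 * (2 * q ^+ 2 * n.+1%:R ^+ 2) * expR (4 + 2 * q ^+ 2))).
    by rewrite ler_wpM2r ?expR_ge0// ler_wpM2l.
  apply: (@le_trans _ _ (C * n.+1%:R ^+ 2)); last first.
    rewrite ler_wpM2l ?ler_weXn2l//.
    by rewrite /C !mulr_ge0 ?expR_ge0 ?exprn_ge0 // ltW.
  have -> : 2 * (2 * q ^+ 2 * n.+1%:R ^+ 2) * expR (4 + 2 * q ^+ 2) =
    4 * q ^+ 2 * expR (4 + 2 * q ^+ 2) * n.+1%:R ^+ 2 by ring.
  rewrite /C ler_wpM2r ?exprn_ge0// ler_wpM2l ?mulr_ge0 ?exprn_ge0 ?(ltW q0)//.
  by rewrite ler_expR; lra.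
have W0 : 0 < 2 * D * expR (4 + 2 * q ^+ 2) * expR ((2 * q^-1 + e / 2) * a).
  by rewrite mulr_gt0 ?expR_gt0// mulr_gt0 ?expR_gt0// mulr_gt0.
rewrite -/m -(ler_pM2l W0).
apply: (@le_trans _ _ (2 * expR (4 + 2 * q ^+ 2) * (Y / 2))); last first.
  have : 2 * expR (4 + 2 * q ^+ 2) * (Y / 2) <= 2 * expR (4 + 2 * q ^+ 2) * (D * (expR ((2 * q^-1 + e / 2) * a) * m)).
    by rewrite ler_wpM2l// mulr_ge0 ?expR_ge0.
  by move=> hh; apply: le_trans hh _; rewrite le_eqVlt; apply/orP; left; apply/eqP; ring.
have -> : 2 * expR (4 + 2 * q ^+ 2) * (Y / 2) = expR (e / 2 * a) * expR ((2 * q - e / 2) * a).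
  have -> : 2 * expR (4 + 2 * q ^+ 2) * (Y / 2) = expR (4 + 2 * q ^+ 2) * Y by field.
  by rewrite /Y -!expRD; congr expR; field.
rewrite -[leLHS]mulrA -[in leLHS]expRD.
have -> : (2 * q^-1 + e / 2) * a + (2 * (q - q^-1) - e) * a = (2 * q - e / 2) * a by field; rewrite gt_eqF.
by rewrite ler_wpM2r ?expR_ge0.
Unshelve. all: by end_near. Qed.

End MomentAsymptotics.

(** * The rate function *)

Section Hyperbolic.
Variable R : realType.
Implicit Types (u v w x y c : R).

Definition sinh (u : R) : R := (expR u - expR (- u)) / 2.

Lemma cosh_lt x y : 0 <= x -> x < y -> cosh x < cosh y.
Proof.
move=> x0 xy; rewrite /cosh ltr_pM2r ?invr_gt0// !expRN.
have ex : 1 <= expR x by rewrite -expR0 ler_expR.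
have exy : expR x < expR y by rewrite ltr_expR.
move: (expR x) (expR y) ex exy => a b a1 ab.
have a0 : 0 < a by lra.
have b0 : 0 < b by lra.
rewrite -subr_gt0.
have -> : b + b^-1 - (a + a^-1) = (b - a) * (1 - (a * b)^-1).
  by field; rewrite !gt_eqF.
rewrite mulr_gt0 ?subr_gt0// invf_lt1 ?mulr_gt0//; nra.
Qed.

Lemma sinh_ge0 u : 0 <= u -> 0 <= sinh u.
Proof. by move=> u0; rewrite divr_ge0// subr_ge0 ler_expR; lra. Qed.

Lemma sqr_cosh u : cosh u ^+ 2 = 1 + sinh u ^+ 2.
Proof.
rewrite /cosh /sinh expRN; have e0 := expR_gt0 u.
by field; rewrite gt_eqF.
Qed.

Lemma is_derive_sinh x : is_derive x 1 sinh (cosh x).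
Proof.
rewrite /sinh /cosh.
have -> : (fun u : R => (expR u - expR (- u)) / 2) =
  (2^-1 : R) \*: ((expR : R -> R) - (expR \o -%R : R -> R))%R.
  by apply/funext => u; rewrite /= mulrC.
apply: is_derive_eq.
by rewrite /GRing.scale /=; lra.
Qed.

Lemma continuous_sinh : continuous sinh.
Proof.
move=> x; apply: differentiable_continuous; apply/derivable1_diffP.
by have [] := is_derive_sinh x.
Qed.

(** Strict convexity of sinh on the half line. Everything about the rate function,
    and the concentration of the tilted law, rests on this inequality. *)
Lemma sinh_tangent u w : 0 <= u -> 0 <= w -> u != w ->
  sinh u + (w - u) * cosh u < sinh w.
Proof.
have mvt a b : a < b -> exists2 c, c \in `]a, b[ & sinh b - sinh a = cosh c * (b - a).
  move=> ab; apply: MVT => // [x _|]; first exact: is_derive_sinh.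
  by apply: continuous_subspaceT => x; exact: continuous_sinh.
move=> u0 w0; rewrite neq_lt => /orP[] uw.
  have [c] := mvt _ _ uw; rewrite in_itv /= => /andP[uc cw] e.
  have := cosh_lt u0 uc; nra.
have [c] := mvt _ _ uw; rewrite in_itv /= => /andP[wc cu] e.
have := cosh_lt (le_trans w0 (ltW wc)) cu; nra.
Qed.

Lemma continuous_cosh : continuous (@cosh R).
Proof.
move=> x; apply: cvgM; last exact: cvg_cst.
apply: cvgD; first exact: continuous_expR.
apply: (@continuous_comp _ _ _ -%R expR); last exact: continuous_expR.
by apply: cvgN; exact: cvg_id.
Qed.

End Hyperbolic.

Section RateFunction.
Variable R : realType.
Implicit Types (u v w x y c : R).

(** The maximizer of [2 w (2 + c) - 4 sinh w] over [w >= 0]. *)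
Definition saddle c : R := acosh (c / 2 + 1).

Lemma saddle_ge0 c : 0 <= c -> 0 <= saddle c.
Proof.
move=> c0; have h : 1 <= c / 2 + 1 by lra.
by have [] := acoshP h.
Qed.

Lemma cosh_saddle c : 0 <= c -> 2 * cosh (saddle c) = 2 + c.
Proof.
move=> c0; have h : 1 <= c / 2 + 1 by lra.
by have [_ ->] := acoshP h; field.
Qed.

Lemma U0_saddle c : 0 <= c ->
  U0 c = 2 * saddle c * (2 + c) - 4 * sinh (saddle c).
Proof.
move=> c0; rewrite /U0 -/(saddle c).
have -> : c ^+ 2 + 4 * c = (2 * sinh (saddle c)) ^+ 2.
  have -> : c ^+ 2 + 4 * c = (2 + c) ^+ 2 - 4 by ring.
  by rewrite -(cosh_saddle c0) exprMn sqr_cosh; ring.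
rewrite sqrtr_sqr ger0_norm; last by rewrite mulr_ge0// sinh_ge0// saddle_ge0.
by ring.
Qed.

(** [U0 c] is the Legendre transform of [th |-> 4 sinh (th / 2)] at [2 + c]: it lies
    above the affine functions
    [c |-> 2 w (2 + c) - 4 sinh w], and touches the one of slope [2 w] only where
    [w = saddle c]. Monotonicity, continuity and convexity follow from this. *)
Lemma U0_gt_line c w : 0 <= c -> 0 <= w -> w != saddle c ->
  2 * w * (2 + c) - 4 * sinh w < U0 c.
Proof.
move=> c0 w0 wu; rewrite U0_saddle//.
have := sinh_tangent (saddle_ge0 c0) w0; rewrite eq_sym => /(_ wu).
by have := cosh_saddle c0; nra.
Qed.

Lemma U0_ge_line c w : 0 <= c -> 0 <= w ->
  2 * w * (2 + c) - 4 * sinh w <= U0 c.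
Proof.
move=> c0 w0; have [->|wu] := eqVneq w (saddle c); first by rewrite U0_saddle.
exact/ltW/U0_gt_line.
Qed.

Lemma saddle_lt x y : 0 <= x -> x < y -> saddle x < saddle y.
Proof.
move=> x0 xy; have y0 : 0 <= y by lra.
rewrite ltNge le_eqVlt; apply/negP => /orP[/eqP e|h].
  by have := cosh_saddle x0; have := cosh_saddle y0; rewrite e; lra.
by have := cosh_lt (saddle_ge0 y0) h; have := cosh_saddle x0; have := cosh_saddle y0; lra.
Qed.

Lemma saddle_le x y : 0 <= x -> x <= y -> saddle x <= saddle y.
Proof.
by move=> x0; rewrite le_eqVlt => /orP[/eqP -> //|/(saddle_lt x0)/ltW].
Qed.

Lemma U0_lt x y : 0 <= x -> x < y -> U0 x < U0 y.
Proof.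
move=> x0 xy; have y0 : 0 <= y by lra.
have u0 := saddle_ge0 x0.
have := U0_gt_line y0 u0; rewrite lt_eqF ?saddle_lt// => /(_ isT).
by rewrite (U0_saddle x0); nra.
Qed.

Lemma U0_at0 : U0 (0 : R) = 0.
Proof.
rewrite U0_saddle// (_ : saddle 0 = 0) ?mulr0 ?mul0r ?sub0r /sinh.
  by rewrite oppr0 subrr mul0r mulr0 oppr0.
rewrite /saddle mul0r add0r -[RHS](@coshK R 0)// /cosh oppr0 expR0.
by congr acosh; field.
Qed.

Lemma U0_ge0 c : 0 <= c -> 0 <= U0 c.
Proof.
by rewrite le_eqVlt => /orP[/eqP <-|/(U0_lt (lexx 0))]; rewrite U0_at0// => /ltW.
Qed.

Lemma U0_lipschitz x y : 0 <= x -> 0 <= y ->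
  `|U0 x - U0 y| <= 2 * saddle (Num.max x y) * `|x - y|.
Proof.
wlog xy : x y / x <= y.
  move=> W x0 y0; have [xy|yx] := orP (le_total x y); first exact: (W _ _ xy).
  by rewrite distrC [`|x - y|]distrC maxC; exact: (W _ _ yx).
move=> x0 y0; rewrite (max_idPr xy) ler0_norm; last first.
  by rewrite subr_le0; move: xy; rewrite le_eqVlt => /orP[/eqP ->//|/(U0_lt x0)/ltW].
rewrite ler0_norm ?subr_le0//.
have := U0_ge_line x0 (saddle_ge0 y0); rewrite (U0_saddle y0); nra.
Qed.

Lemma U0_continuous : {within `[0, +oo[%classic, continuous (@U0 R)}%classic.
Proof.
apply/subspace_continuousP => x /=; rewrite in_itv /= andbT => x0.
apply/cvgrPdist_le => e e0.
pose L := 2 * saddle (x + 1) + 1.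
have L0 : 0 < L by have := @saddle_ge0 (x + 1); rewrite /L; lra.
have : \forall y \near nbhs x, `|x - y| < Num.min 1 (e / L).
  by apply: cvgr_dist_lt => //; rewrite lt_min ltr01 divr_gt0.
apply: filterS => y; rewrite lt_min => /andP[y1 ye]; rewrite /= in_itv /= andbT => y0.
apply: (le_trans (U0_lipschitz x0 y0)).
have m0 : 0 <= Num.max x y by rewrite le_max x0.
have m1 : Num.max x y <= x + 1.
  by rewrite ge_max lerDl ler01 /=; move: y1; rewrite ltr_norml; lra.
have s0 := saddle_le m0 m1; have s1 := saddle_ge0 m0.
rewrite ltr_pdivlMr// in ye; have := normr_ge0 (x - y); rewrite /L in ye; nra.
Qed.

Lemma U0_convex : convex_function (`[0, +oo[%classic : set R) (@U0 R).
Proof.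
have mix (t x y : R) : 0 <= t <= 1 -> 0 <= x -> 0 <= y ->
    U0 (t * x + (1 - t) * y) <= t * U0 x + (1 - t) * U0 y.
  move=> /andP[t0 t1] x0 y0.
  have c0 : 0 <= t * x + (1 - t) * y by nra.
  have u0 := saddle_ge0 c0; rewrite U0_saddle//.
  have hx := U0_ge_line x0 u0; have hy := U0_ge_line y0 u0.
  have h1 := ler_wpM2l t0 hx.
  have t1' : 0 <= 1 - t by rewrite subr_ge0.
  have h2 := ler_wpM2l t1' hy; lra.
move=> t x y /set_mem + /set_mem; rewrite /= !in_itv /= !andbT => x0 y0.
rewrite [leRHS]convRE [X in U0 X](convRE x y t); apply: mix => //.
by apply/andP; split.
Qed.

End RateFunction.

(** * Large deviations *)

Section Tail.
Variable R : realType.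
Implicit Types (u v w x y c e : R) (n : nat).

Definition lis_tail x n : R :=
  uniform_perm_prob R (fun s : 'S_n => x * Num.sqrt n%:R <= (Lmax s)%:R).

Lemma lis_tailE x n :
  lis_tail x n =
  mean_perm (fun s : 'S_n => (x * Num.sqrt n%:R <= (Lmax s)%:R :> R)%:R).
Proof.
rewrite /lis_tail /uniform_perm_prob mulrC /mean_perm card_Sn; congr (_ * _).
by rewrite -sum1_card natr_sum big_mkcond; apply: eq_bigr => s _; rewrite unfold_in; case: ifP.
Qed.

Lemma lis_tail_anti x y n : x <= y -> lis_tail y n <= lis_tail x n.
Proof.
move=> xy; rewrite !lis_tailE; apply: mean_perm_le => s; rewrite ler_nat.
case: (boolP (y * _ <= _)) => // h.
have -> // : x * Num.sqrt n%:R <= (Lmax s)%:R.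
by apply: le_trans h; rewrite ler_wpM2r ?sqrtr_ge0.
Qed.

Lemma expR_sqr_pow u (k : nat) : (expR u ^+ 2) ^+ k = expR (2 * u * k%:R).
Proof. by rewrite -!expRM_natl; congr expR; ring. Qed.

Lemma chernoff x u n : 0 <= u ->
  lis_tail x n <=
  expR (- (2 * u * x * Num.sqrt n%:R)) * lis_mgf (expR u ^+ 2) n.
Proof.
move=> u0; rewrite lis_tailE -mean_permZ; apply: mean_perm_le => s.
rewrite expR_sqr_pow -expRD.
case: (boolP (x * _ <= _)) => h; last exact: expR_ge0.
rewrite -[X in X <= _]expR0 ler_expR addrC subr_ge0 -[2 * u * x * _]mulrA.
by rewrite ler_wpM2l// mulr_ge0.
Qed.

Lemma lis_mgf_expR_le u n : 0 <= u ->
  lis_mgf (expR u ^+ 2) n <= expR 5 * n.+1%:R * expR (4 * sinh u * Num.sqrt n%:R).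
Proof.
move=> u0; have q1 : 1 <= expR u by rewrite -expR0 ler_expR.
apply: (le_trans (lis_mgf_le n q1)); rewrite le_eqVlt; apply/orP; left; apply/eqP.
by rewrite -expRN /sinh; congr (_ * expR _); field.
Qed.

Lemma lis_mgf_expR_ge u e : 0 < u -> 0 < e ->
  \forall n \near \oo%classic,
    expR ((4 * sinh u - e) * Num.sqrt n%:R) <= lis_mgf (expR u ^+ 2) n.
Proof.
move=> u0 e0; have q1 : 1 < expR u by rewrite -expR0 ltr_expR.
have := lis_mgf_ge q1 e0; apply: filterS => n; apply: le_trans.
rewrite le_eqVlt; apply/orP; left; apply/eqP.
by rewrite -expRN /sinh; congr expR; field.
Qed.

(** Pointwise, with [L] the longest increasing subsequence: if [L] is below
    [2 cosh v sqrt n], replacing the tilt [u] by the smaller [v] costs at most the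
    factor displayed; if [L] is above [2 cosh v' sqrt n], the same holds for the
    larger [v']; in between, [e^(2uL)] is at most the last exponential. *)
Lemma lis_mgf_split u v v' n : 0 <= v -> v <= u -> u <= v' ->
  lis_mgf (expR u ^+ 2) n <=
    expR (4 * (u - v) * cosh v * Num.sqrt n%:R) * lis_mgf (expR v ^+ 2) n +
    expR (4 * (u - v') * cosh v' * Num.sqrt n%:R) * lis_mgf (expR v' ^+ 2) n +
    expR (4 * u * cosh v' * Num.sqrt n%:R) * lis_tail (2 * cosh v) n.
Proof.
move=> v0 vu uv'.
rewrite lis_tailE -!mean_permZ -!mean_permD; apply: mean_perm_le => s.
rewrite !expR_sqr_pow -!expRD; set a := Num.sqrt _; set l := (Lmax s)%:R.
have [hl|hl] := leP (2 * cosh v * a) l; last first.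
  rewrite mulr0 addr0 ler_wpDr ?expR_ge0// ler_expR.
  by have := ler_wpM2l (_ : 0 <= u - v); rewrite subr_ge0 => /(_ vu _ _ (ltW hl)); lra.
have [hl'|/ltW hl'] := leP l (2 * cosh v' * a).
  rewrite mulr1 ler_wpDl ?addr_ge0 ?expR_ge0// ler_expR.
  by have := ler_wpM2l (le_trans v0 vu) hl'; lra.
rewrite -addrA ler_wpDl ?expR_ge0// ler_wpDr ?mulr_ge0 ?expR_ge0// ler_expR.
by have := ler_wpM2l (_ : 0 <= v' - u); rewrite subr_ge0 => /(_ uv' _ _ hl'); lra.
Qed.

(** The two outer terms of [lis_mgf_split] have exponents smaller than
    [4 sinh u] by the gaps [g1] and [g2], positive by strict convexity. *)
Lemma lis_tail_ge u v v' e : 0 < v -> v < u -> u < v' -> 0 < e ->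
  \forall n \near \oo%classic,
    expR (- ((4 * u * cosh v' - 4 * sinh u + e) * Num.sqrt n%:R)) <=
    lis_tail (2 * cosh v) n.
Proof.
move=> v0 vu uv' e0.
have u0 : 0 < u by exact: lt_trans vu.
have v'0 : 0 < v' by exact: lt_trans uv'.
pose g1 := 4 * (sinh u - (sinh v + (u - v) * cosh v)).
pose g2 := 4 * (sinh u - (sinh v' + (u - v') * cosh v')).
have g10 : 0 < g1.
  by rewrite mulr_gt0// subr_gt0 sinh_tangent ?ltW// lt_eqF.
have g20 : 0 < g2.
  by rewrite mulr_gt0// subr_gt0 sinh_tangent ?ltW// gt_eqF.
pose d := Num.min (e / 2) (Num.min g1 g2 / 2).
have d0 : 0 < d by rewrite lt_min !divr_gt0// lt_min g10.
have de : d <= e / 2 by rewrite ge_min lexx.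
have dg : d <= Num.min g1 g2 / 2 by rewrite ge_min lexx orbT.
have dg1 : 2 * d <= g1.
  have : Num.min g1 g2 <= g1 by rewrite ge_min lexx. by lra.
have dg2 : 2 * d <= g2.
  have : Num.min g1 g2 <= g2 by rewrite ge_min lexx orbT. by lra.
near=> n.
have lo : expR ((4 * sinh u - d) * Num.sqrt n%:R) <= lis_mgf (expR u ^+ 2) n.
  by near: n; exact: lis_mgf_expR_ge.
have P1 : 4 * expR 5 * n.+1%:R ^+ 3 <= expR (d * Num.sqrt n%:R).
  by near: n; exact: poly_le_expR_sqrt.
have P2 : 2 * n.+1%:R ^+ 3 <= expR (e / 2 * Num.sqrt n%:R).
  by near: n; apply: poly_le_expR_sqrt; exact: divr_gt0.
set a := Num.sqrt n%:R in lo P1 P2 *; have a0 : 0 <= a by exact: sqrtr_ge0.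
have n1 : (1 : R) <= n.+1%:R by rewrite ler1n.
have n3 : n.+1%:R <= n.+1%:R ^+ 3 :> R by rewrite exprS ler_peMr// exprn_ege1.
have n3' : (1 : R) <= n.+1%:R ^+ 3 by exact: exprn_ege1.
have far w : 0 <= w -> 2 * d <= 4 * (sinh u - (sinh w + (u - w) * cosh w)) ->
    expR (4 * (u - w) * cosh w * a) * lis_mgf (expR w ^+ 2) n <=
    expR ((4 * sinh u - d) * a) / 4.
  move=> w0 gw; apply: (le_trans (ler_wpM2l (expR_ge0 _) (lis_mgf_expR_le n w0))).
  rewrite mulrCA -expRD -/a.
  have -> : (4 * sinh u - d) * a = d * a + (4 * sinh u - 2 * d) * a by ring.
  rewrite [in leRHS]expRD ler_pdivlMr// mulrC [leLHS]mulrA.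
  apply: ler_pM; rewrite ?mulr_ge0 ?expR_ge0//.
    apply: le_trans P1; rewrite mulrA; apply: ler_wpM2l n3.
    by rewrite mulr_ge0 ?expR_ge0.
  rewrite ler_expR -mulrDl ler_wpM2r//; lra.
have := lis_mgf_split n (ltW v0) (ltW vu) (ltW uv'); rewrite -/a => sp.
have f1 := far v (ltW v0) dg1; have f2 := far v' (ltW v'0) dg2.
have h : expR ((4 * sinh u - d) * a) / 2 <= expR (4 * u * cosh v' * a) * lis_tail (2 * cosh v) n.
  by move: (le_trans lo sp) f1 f2; lra.
rewrite -(ler_pM2l (expR_gt0 (4 * u * cosh v' * a))) (le_trans _ h)//.
rewrite -expRD ler_pdivlMr//.
have -> : (4 * sinh u - d) * a = (4 * u * cosh v' * a - (4 * u * cosh v' - 4 * sinh u + e) * a) + (e - d) * a by ring.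
rewrite [leRHS]expRD ler_wpM2l ?expR_ge0//.
apply: (@le_trans _ _ (expR (e / 2 * a))); first by lra.
by rewrite ler_expR ler_wpM2r//; lra.
Unshelve. all: by end_near. Qed.

Lemma lis_tail_upper c e : 0 <= c -> 0 < e ->
  \forall n \near \oo%classic,
    lis_tail (2 + c) n <= expR (- ((U0 c - e) * Num.sqrt n%:R)).
Proof.
move=> c0 e0; have u0 := saddle_ge0 c0; near=> n.
have P : expR 5 * n.+1%:R ^+ 3 <= expR (e * Num.sqrt n%:R) :> R.
  by near: n; exact: poly_le_expR_sqrt.
set a := Num.sqrt n%:R in P *.
apply: (le_trans (chernoff _ _ u0)).
apply: (le_trans (ler_wpM2l (expR_ge0 _) (lis_mgf_expR_le n u0))).
rewrite mulrCA -expRD -/a.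
have -> : - ((U0 c - e) * a) = e * a + (- (2 * saddle c * (2 + c) * a) + 4 * sinh (saddle c) * a).
  by rewrite U0_saddle//; ring.
rewrite [in leRHS]expRD ler_wpM2r ?expR_ge0// (le_trans _ P)// ler_wpM2l ?expR_ge0//.
have n1 : (1 : R) <= n.+1%:R by rewrite ler1n.
by rewrite exprS ler_peMr// exprn_ege1.
Unshelve. all: by end_near. Qed.

(** As [v < u < v'] decrease to [saddle c], the exponent of [lis_tail_ge] tends to
    [U0 c]; they are taken at distances [h], [2 h] and [3 h]. *)
Lemma lis_tail_lower c e : 0 <= c -> 0 < e ->
  \forall n \near \oo%classic,
    expR (- ((U0 c + e) * Num.sqrt n%:R)) <= lis_tail (2 + c) n.
Proof.
move=> c0 e0; have u0 := saddle_ge0 c0; set u := saddle c in u0.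
pose F (h : R) : R := 4 * (u + 2 * h) * cosh (u + 3 * h) - 4 * sinh (u + 2 * h).
have F0 : F 0 = U0 c.
  by rewrite /F !mulr0 !addr0 U0_saddle// -cosh_saddle// -/u; ring.
have Fc : (F h @[h --> (0 : R)] --> F 0)%classic.
  have lin (k : R) : (u + k * h @[h --> (0 : R)] --> u + k * 0)%classic.
    by apply: cvgD; [exact: cvg_cst|apply: cvgM; [exact: cvg_cst|exact: cvg_id]].
  apply: cvgB; apply: cvgM.
  - by apply: cvgM; [exact: cvg_cst|exact: lin].
  - exact: (cvg_comp _ _ (lin 3) (@continuous_cosh R _)).
  - exact: cvg_cst.
  - exact: (cvg_comp _ _ (lin 2) (@continuous_sinh R _)).
have [h h0 Fh] : exists2 h : R, 0 < h & F h <= U0 c + e / 2.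
  have e2 : 0 < e / 2 by rewrite divr_gt0.
  move/cvgrPdist_le : Fc => /(_ _ e2) Fe.
  near (0 : R)^'+%classic => h; exists h; first by near: h; exact: nbhs_right_gt.
  have : `|F 0 - F h| <= e / 2 by near: h; exact: cvg_within Fe.
  by rewrite F0 ler_norml; lra.
have v0 : 0 < u + h by lra.
have vu : u + h < u + 2 * h by lra.
have uv : u + 2 * h < u + 3 * h by lra.
have e2 : 0 < e / 2 by rewrite divr_gt0.
have := lis_tail_ge v0 vu uv e2; apply: filterS => n H.
apply: (@le_trans _ _ (lis_tail (2 * cosh (u + h)) n)); last first.
  by apply: lis_tail_anti; rewrite -cosh_saddle// ler_pM2l// ltW// cosh_lt// -/u; lra.
apply: le_trans H; rewrite ler_expR lerN2 ler_wpM2r//.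
by move: Fh; rewrite /F; lra.
Unshelve. all: by end_near. Qed.

Lemma lis_tail_rate c : 0 <= c ->
  ((Num.sqrt (n%:R : R))^-1 * ln (lis_tail (2 + c) n) @[n --> \oo] --> - U0 c)%classic.
Proof.
move=> c0; apply/cvgrPdist_le => e e0; near=> n.
have lo : expR (- ((U0 c + e) * Num.sqrt n%:R)) <= lis_tail (2 + c) n.
  by near: n; exact: lis_tail_lower.
have up : lis_tail (2 + c) n <= expR (- ((U0 c - e) * Num.sqrt n%:R)).
  by near: n; exact: lis_tail_upper.
have a0 : 0 < Num.sqrt (n%:R : R).
  by rewrite sqrtr_gt0 ltr0n; near: n; exact: nbhs_infty_gt.
set a := Num.sqrt n%:R in lo up a0 *.
have p0 : 0 < lis_tail (2 + c) n := lt_le_trans (expR_gt0 _) lo.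
rewrite -ler_ln ?posrE ?expR_gt0// expRK in lo.
rewrite -ler_ln ?posrE ?expR_gt0// expRK in up.
have l1 : - (U0 c + e) <= a^-1 * ln (lis_tail (2 + c) n).
  by rewrite mulrC ler_pdivlMr// mulNr.
have l2 : a^-1 * ln (lis_tail (2 + c) n) <= - (U0 c - e).
  by rewrite mulrC ler_pdivrMr// mulNr.
by rewrite ler_norml; lra.
Unshelve. all: by end_near. Qed.

End Tail.

Local Open Scope classical_set_scope.
Local Open Scope ring_scope.

Theorem theorem2 (R : realType) :
  (forall c : R, 0 <= c ->
    (fun n : nat => (Num.sqrt (n%:R : R))^-1 *
       ln (uniform_perm_prob R
             (fun s : 'S_n => (2 + c) * Num.sqrt n%:R <= (Lmax s)%:R)))
      @ \oo --> - U0 c)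
  /\ (forall c : R, 0 <= c -> 0 <= U0 c)
  /\ {within `[0, +oo[, continuous (@U0 R)}
  /\ {in `[0, +oo[ &, {homo @U0 R : x y / x < y}}
  /\ convex_function (`[0, +oo[%classic : set R) (@U0 R)
  /\ (forall c : R, 0 <= c -> (U0 c = 0 <-> c = 0)).
Proof.
split; first exact: lis_tail_rate.
split; first exact: U0_ge0.
split; first exact: U0_continuous.
split; first by move=> x y; rewrite !in_itv /= !andbT => x0 _; exact: U0_lt.
split; first exact: U0_convex.
move=> c c0; split => [U00|->]; last exact: U0_at0.
apply/eqP; rewrite eq_le c0 andbT leNgt; apply/negP => cp.
by have := U0_lt (lexx 0) cp; rewrite U0_at0 U00 ltxx.
Qed.
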